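(* Let $(Z,S)$ be an infinite strictly ergodic topological dynamical system, let $Y$ be a nonempty compact metric space, and let $\mathcal G$ be a closed, pathwise connected subgroup of the group of all homeomorphisms of $Y$ (equipped with the uniform metric) with the following property: for every nonempty open set $V\subset Y$ and every $\epsilon>0$ there are homeomorphisms $h_1,h_2,\dots,h_M\in\mathcal G$ such that $$\frac1M\sum_{j=1}^M\mathbf 1_{h_j(Y\setminus V)}(y)\le\epsilon\quad\text{for all }y\in Y.$$ Then for a generic cocycle $G\in\overline{\mathsf{Cob}}(\mathcal G)$ (i.e. for all $G$ in a residual subset of $\overline{\mathsf{Cob}}(\mathcal G)$), the corresponding skew product extension $(X,T_G)$ of $(Z,S)$, where $X=Z\times Y$ and $T_G(z,y)=(Sz,G_z(y))$, is both minimal and an isomorphic extension of $(Z,S)$ (via the projection $\pi:Z\times Y\to Z$).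
   Context: A topological dynamical system is a homeomorphism of a compact metric space; it is strictly ergodic if it is minimal (every orbit is dense) and uniquely ergodic (exactly one invariant Borel probability measure). $\mathbf 1_F$ is the characteristic function of a set $F$. The group of homeomorphisms of $Y$ carries the topology of the uniform metric $d(g,h)=\sup_{y\in Y}d_Y(g(y),h(y))$; with this topology $\mathcal G$ is a Polish topological group. $C(Z,\mathcal G)$ denotes the set of all continuous maps $G:Z\to\mathcal G$, $z\mapsto G_z$, called cocycles; with the uniform topology and pointwise operations $(GH)_z=G_zH_z$, $(G^{-1})_z=(G_z)^{-1}$ it is a Polish group. For $G\in C(Z,\mathcal G)$ put $(G_S)_z=G_{Sz}$; the associated coboundary is $G_S^{-1}G\in C(Z,\mathcal G)$, i.e. $(G_S^{-1}G)_z=G_{Sz}^{-1}\circ G_z$. $\mathsf{Cob}(\mathcal G)=\{G_S^{-1}G: G\in C(Z,\mathcal G)\}$, and $\overline{\mathsf{Cob}}(\mathcal G)$ is its closure in $C(Z,\mathcal G)$, a Polish space. A residual subset of a Polish space is one containing a dense $G_\delta$ subset. A system $(X,T)$ is an isomorphic extension of $(Z,S)$ via a topological factor map $\pi:X\to Z$ (a continuous surjection with $\pi\circ T=S\circ\pi$) if $(X,T)$ is uniquely ergodic, with unique invariant measure $\mu$, and $\pi$ is also a measure-theoretic isomorphism between $(X,\mu,T)$ and $(Z,\nu,S)$, where $\nu$ is the unique invariant measure of $(Z,S)$ and the sigma-algebras are the completed Borel sigma-algebras (i.e. $\pi$ becomes a bimeasurable bijection after discarding null sets in $X$ and $Z$).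 *)

(* Defs.v *)
From HB Require Import structures.
From mathcomp Require Import all_boot all_order all_algebra.
From mathcomp Require Import all_classical all_reals all_analysis measurable_realfun
  borel_hierarchy.
Import Order.TTheory GRing.Theory Num.Theory.
Import numFieldNormedType.Exports.

Set Implicit Arguments.
Unset Strict Implicit.
Unset Printing Implicit Defensive.

Local Open Scope classical_set_scope.
Local Open Scope ring_scope.

(* The library equips only pointed types with sigma-algebras, hence nonempty
   metric spaces are given with a distinguished point. *)
#[short(type="pmetricType")]
HB.structure Definition PointedMetric (K : numDomainType) :=
  {M of Metric K M & Pointed M}.

HB.instance Definition _ (X Y : ptopologicalType) := Pointed.on (X * Y)%type.

Record homeo (Y : topologicalType) := Homeo {
  homeo_fun :> Y -> Y ;
  homeo_inv : Y -> Y ;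
  homeo_funK : cancel homeo_fun homeo_inv ;
  homeo_invK : cancel homeo_inv homeo_fun ;
  homeo_fun_continuous : continuous homeo_fun ;
  homeo_inv_continuous : continuous homeo_inv }.

HB.instance Definition _ (Y : topologicalType) := gen_eqMixin (homeo Y).
HB.instance Definition _ (Y : topologicalType) := gen_choiceMixin (homeo Y).

Section homeo_group.
Context {Y : topologicalType}.
Implicit Types f g h : homeo Y.

Lemma homeo_ext f g : f =1 g -> f = g.
Proof.
case: f g => [f f' fK f'K cf cf'] [g g' gK g'K cg cg'] /= /funext fg.
subst g; have fg' : f' = g' by apply/funext => y; rewrite -[y in LHS]g'K fK.
by subst g'; congr Homeo; exact: Prop_irrelevance.
Qed.

Definition homeo_id : homeo Y :=
  @Homeo Y idfun idfun (fun=> erefl) (fun=> erefl)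
    (fun=> cvg_id) (fun=> cvg_id).

Definition homeo_comp f g : homeo Y :=
  @Homeo Y (f \o g) (homeo_inv g \o homeo_inv f)
    (can_comp (homeo_funK f) (homeo_funK g))
    (can_comp (homeo_invK g) (homeo_invK f))
    (fun x => continuous_comp (@homeo_fun_continuous _ g x)
                              (@homeo_fun_continuous _ f (g x)))
    (fun x => continuous_comp (@homeo_inv_continuous _ f x)
                              (@homeo_inv_continuous _ g (homeo_inv f x))).

Definition homeo_opp f : homeo Y :=
  @Homeo Y (homeo_inv f) f (homeo_invK f) (homeo_funK f)
    (@homeo_inv_continuous _ f) (@homeo_fun_continuous _ f).

Let homeo_compA : associative homeo_comp.
Proof. by move=> f g h; exact: homeo_ext. Qed.

Let homeo_id_comp : left_id homeo_id homeo_comp.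
Proof. by move=> f; exact: homeo_ext. Qed.

Let homeo_comp_id : right_id homeo_id homeo_comp.
Proof. by move=> f; exact: homeo_ext. Qed.

Let homeo_oppV : left_inverse homeo_id homeo_opp homeo_comp.
Proof. by move=> f; apply: homeo_ext => y /=; rewrite homeo_funK. Qed.

Let homeo_Vopp : right_inverse homeo_id homeo_opp homeo_comp.
Proof. by move=> f; apply: homeo_ext => y /=; rewrite homeo_invK. Qed.

HB.instance Definition _ := isGroup.Build (homeo Y)
  homeo_compA homeo_id_comp homeo_comp_id homeo_oppV homeo_Vopp.

End homeo_group.

(* Uniform convergence, i.e. the topology of the metric
   sup_y d (g y) (h y). *)
HB.instance Definition _ (Y : uniformType) := Uniform.copy (homeo Y)
  (initial_topology (fun g : homeo Y => (g : Y -> Y) : {uniform Y -> Y})).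

Lemma homeo_near (Y : uniformType) (g : homeo Y) (E : set (Y * Y)) :
  entourage E -> nbhs g [set h : homeo Y | forall y, E (g y, h y)].
Proof.
move=> entE.
have /(_ g) := @initial_continuous _ _
  (fun g : homeo Y => (g : Y -> Y) : {uniform Y -> Y}).
move=> /(_ [set h : {uniform Y -> Y} | forall y, E (g y, h y)]); apply.
by apply/uniform_nbhs; exists E; split => // h /= Eh y; exact: Eh.
Qed.

Lemma homeo_eval_continuous (Y : uniformType) :
  continuous (fun p : homeo Y * Y => p.1 p.2).
Proof.
move=> [g y]; apply/cvg_entourageP => /= E entE.
have cg := @homeo_fun_continuous _ g y.
exists ([set h : homeo Y | forall y', split_ent E (g y', h y')],
        [set y' | split_ent E (g y, g y')]) => /=.
  split; first exact: homeo_near.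
  by move/cvg_entourageP : cg; exact.
by move=> [h y'] /= [hg yy']; exact: entourage_split (hg y').
Qed.

Lemma homeo_eval_inv_continuous (Y : uniformType) :
  continuous (fun p : homeo Y * Y => (p.1^-1)%g p.2).
Proof.
move=> [g y] B /= Bgy.
have := @homeo_inv_continuous _ g y B Bgy.
rewrite /= nbhs_simpl/= -nbhs_entourageE => -[E entE EB].
exists ([set h : homeo Y | forall u, (split_ent E)^-1%relation (g u, h u)],
        [set y' | split_ent E (y, y')]) => /=.
  split; first exact: (homeo_near g (entourage_inv (entourage_split_ent entE))).
  by rewrite -nbhs_entourageE; exists (split_ent E) => // z /xsectionP.
move=> [h y'] /= [hg yy'].
have /= := hg (homeo_inv h y'); rewrite homeo_invK => hgy'.
have /= := EB (g (homeo_inv h y')); rewrite homeo_funK; apply.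
by apply/xsectionP; exact: entourage_split hgy'.
Qed.

Lemma continuousT_comp (X U V : topologicalType) (f : X -> U) (g : U -> V) :
  continuous f -> continuous g -> continuous (fun x => g (f x)).
Proof. by move=> cf cg x; exact: continuous_comp (cf x) (cg (f x)). Qed.

Lemma continuous_pairing (X U V : topologicalType) (f : X -> U) (g : X -> V) :
  continuous f -> continuous g -> continuous (fun x => (f x, g x)).
Proof.
move=> cf cg x A [[B C] /= [fB gC] BCA].
have xB : nbhs x (f @^-1` B) := cf x B fB.
have xC : nbhs x (g @^-1` C) := cg x C gC.
suff: nbhs x ((fun x => (f x, g x)) @^-1` A) by [].
by apply: filterS (filterI xB xC) => y [By Cy]; exact: (BCA (f y, g y)).
Qed.

Definition path_connected (R : realType) {T : topologicalType} (A : set T) :=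
  forall x y, A x -> A y -> exists p : R -> T,
    [/\ {within `[0, 1], continuous p}, p 0 = x, p 1 = y
      & p @` `[0, 1] `<=` A].

Section cocycle.
Context {Z : topologicalType} {Y : uniformType}.
Variable GG : set (homeo Y).

(* C(Z, GG), with the topology of uniform convergence: as a type it is the
   subspace of this subset of {uniform Z -> homeo Y}. *)
Definition cocycles : set {uniform Z -> homeo Y} :=
  [set G | continuous (G : Z -> homeo Y) /\ forall z, GG (G z)].

Definition cocycle_fun (G : cocycles) : Z -> homeo Y := val G.

Lemma cocycle_continuous (G : cocycles) : continuous (cocycle_fun G).
Proof. by have [] := set_valP G. Qed.

(* When GG is a topological group, every z |-> (G (S z))^-1 * G z lies in
   C(Z, GG), so restricting H to that space excludes no coboundary. *)
Definition coboundaries (S : homeo Z) : set cocycles :=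
  [set H | exists G : cocycles,
     forall z, cocycle_fun H z = ((cocycle_fun G (S z))^-1 * cocycle_fun G z)%g].

Section skew_product.
Variables (S : homeo Z) (G : cocycles).

Definition skew_fun (x : Z * Y) : Z * Y := (S x.1, cocycle_fun G x.1 x.2).

Definition skew_inv (x : Z * Y) : Z * Y :=
  ((S^-1)%g x.1, ((cocycle_fun G ((S^-1)%g x.1))^-1)%g x.2).

Lemma skew_funK : cancel skew_fun skew_inv.
Proof.
by move=> [z y]; rewrite /skew_inv /skew_fun /= homeo_funK homeo_funK.
Qed.

Lemma skew_invK : cancel skew_inv skew_fun.
Proof.
by move=> [z y]; rewrite /skew_inv /skew_fun /= homeo_invK homeo_invK.
Qed.

Let fst_continuous : continuous (@fst Z Y).
Proof. by move=> x; exact: cvg_fst. Qed.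

Let snd_continuous : continuous (@snd Z Y).
Proof. by move=> x; exact: cvg_snd. Qed.

Lemma skew_fun_continuous : continuous skew_fun.
Proof.
have cS := continuousT_comp fst_continuous (@homeo_fun_continuous _ S).
have cG := continuousT_comp fst_continuous (@cocycle_continuous G).
exact: (continuous_pairing cS (continuousT_comp
  (continuous_pairing cG snd_continuous) (@homeo_eval_continuous Y))).
Qed.

Lemma skew_inv_continuous : continuous skew_inv.
Proof.
have cS := continuousT_comp fst_continuous (@homeo_inv_continuous _ S).
have cG := continuousT_comp cS (@cocycle_continuous G).
exact: (continuous_pairing cS (continuousT_comp
  (continuous_pairing cG snd_continuous) (@homeo_eval_inv_continuous Y))).
Qed.

Definition skew_product : homeo (Z * Y)%type :=
  Homeo skew_funK skew_invK skew_fun_continuous skew_inv_continuous.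

End skew_product.
End cocycle.

Arguments coboundaries {Z Y} GG S.

Definition residual {T : topologicalType} (P : set T) :=
  exists D : set T, [/\ Gdelta D, dense D & D `<=` P].

Definition full_orbit {X : topologicalType} (T : homeo X) (x : X) : set X :=
  [set (T ^+ n)%g x | n in [set: nat]] `|` [set (T ^- n)%g x | n in [set: nat]].

Definition minimal {X : topologicalType} (T : homeo X) :=
  forall x, dense (full_orbit T x).

Notation borel X := (g_sigma_algebraType (@open X)).

Section unique_ergodicity.
Context {R : realType} {X : ptopologicalType}.
Implicit Type mu : probability (borel X) R.

Definition invariant_measure (T : homeo X) mu :=
  forall A : set (borel X), measurable A -> mu (T @^-1` A) = mu A.

(* Measures are functions on all subsets, unconstrained outside of the
   sigma-algebra, so they are compared on Borel sets only. *)
Definition unique_invariant_measure (T : homeo X) mu :=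
  invariant_measure T mu /\
  forall mu', invariant_measure T mu' ->
    forall A : set (borel X), measurable A -> mu' A = mu A.

End unique_ergodicity.

Definition uniquely_ergodic (R : realType) {X : ptopologicalType}
    (T : homeo X) :=
  exists mu : probability (borel X) R,
    unique_invariant_measure T mu.

Definition strictly_ergodic (R : realType) {X : ptopologicalType}
    (T : homeo X) :=
  minimal T /\ uniquely_ergodic R T.

Definition factor_map {X Z : topologicalType} (T : homeo X) (S : homeo Z)
    (pi : X -> Z) :=
  [/\ continuous pi, set_surj setT setT pi & forall x, pi (T x) = S (pi x)].

(* pi is a bimeasurable bijection for the completed sigma-algebras outside of
   null sets. The completed sigma-algebras only enter through completed_algebra_gen;
   preservation of the completed measures follows from that on Borel sets. *)
Definition measure_isomorphism {R : realType} {X Z : ptopologicalType}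
    (mu : probability (borel X) R)
    (nu : probability (borel Z) R) (pi : X -> Z) :=
  (forall B : set (borel Z),
     measurable B -> mu (pi @^-1` B) = nu B) /\
  exists (X0 : set X) (Z0 : set Z),
    [/\ mu.-negligible (~` X0), nu.-negligible (~` Z0), set_bij X0 Z0 pi
      & forall A : set X, A `<=` X0 ->
          completed_algebra_gen mu A <-> completed_algebra_gen nu (pi @` A)].

Definition isomorphic_extension (R : realType) {X Z : ptopologicalType}
    (T : homeo X) (S : homeo Z) (pi : X -> Z) :=
  factor_map T S pi /\
  exists (mu : probability (borel X) R)
         (nu : probability (borel Z) R),
    [/\ unique_invariant_measure T mu, unique_invariant_measure S nu
      & measure_isomorphism mu nu pi].

(* Main.v *)
Require Import Defs.
From HB Require Import structures.
From mathcomp Require Import all_boot all_order all_algebra.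
From mathcomp Require Import all_classical all_reals all_analysis.
From mathcomp Require Import measurable_realfun borel_hierarchy lra ring zify.
Import Order.TTheory GRing.Theory Num.Theory.
Import numFieldNormedType.Exports.

(** The space of cocycles in the closure of the coboundaries is a Baire space
    (lemma [cob_baire]), and the two properties of the theorem follow from
    countably many conditions on a cocycle [G], each of them open and dense.
    Write [T] for the skew product and [G^n_z] for its [n]-th iterate in the
    fibre over [z].

    - [visits U]: every orbit of [T] enters [U] before a fixed time. For [U] in
      a countable base of [Z * Y] these conditions give minimality.
    - [mean_contracting e]: for some [N], the average over [n < N] of the
      distance from [G^n_z y1] to [G^n_z y2] is below [e], uniformly in [z],
      [y1] and [y2].

    Openness is compactness. Density is checked near a coboundary
    [H_z = G_(Sz)^-1 G_z], whose skew product is conjugate to [S] times the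
    identity. Replacing [G] by [K G], where [K_(Sz)^-1 K_z] is close to the
    identity, moves [H] little, and turns the orbit of [(z, y)] into
    [(S^n z, G_w^-1 K_w^-1 y')] with [w = S^n z] and [y'] fixed. If
    [K_w^-1 y'] lies, for every [y'] and along every orbit, in a given small
    open set [V] most of the time, then both conditions hold for the new
    coboundary. Such a [K] is built in [tower_cocycle]: it moves slowly along a
    closed path through the homeomorphisms [h_1, .., h_M] attached to [V] by the
    hypothesis, spending the same time near each of them. Its position on the
    path is the function [min a b] of [slow_function], where [a] is roughly the
    time since, and [b] the time until, a visit to a small ball. That function
    increases or decreases by exactly one at almost every step, so that the path
    is run through at unit speed, forwards or backwards, most of the time.

    Now let [G] be mean contracting for every [e]. A coboundary near [G]
    has a continuous invariant section [z |-> G'_z^-1 y]; it is almost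
    invariant for [G], and by contraction all almost invariant sections are
    close to each other, and to the second coordinate, in the mean for any
    invariant measure. A fast sequence of such sections converges almost
    everywhere to a measurable invariant section [phi], and every invariant
    measure of [T] is carried by the graph of [phi]
    ([isomorphic_extension_of_sections]). Hence there is exactly one, and the
    projection is an isomorphism. *)

Set Implicit Arguments.
Unset Strict Implicit.
Unset Printing Implicit Defensive.

Local Open Scope classical_set_scope.
Local Open Scope ring_scope.
Import metricType_numDomainType.

(** * The topology of cocycles *)

(** The tube lemma, in the form used for every openness statement below. *)
Lemma near_compactT (X : topologicalType) (I : Type) (F : set_system I)
    (P : I -> X -> Prop) : Filter F -> compact [set: X] ->
  (forall x : X, \forall x' \near x & i \near F, P i x') ->
  \forall i \near F, forall x, P i x.
Proof.
move=> FF /compact_near_coveringP cX PF.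
have := cX I F P FF (fun x _ => PF x).
by apply: filterS => i Pi x; exact: Pi.
Qed.

Lemma continuous_fst (X X' : topologicalType) : continuous (@fst X X').
Proof. by move=> x; exact: cvg_fst. Qed.

Lemma continuous_snd (X X' : topologicalType) : continuous (@snd X X').
Proof. by move=> x; exact: cvg_snd. Qed.

Lemma iter_continuous (X : topologicalType) (f : X -> X) n :
  continuous f -> continuous (iter n f).
Proof.
move=> cf; elim: n => [|n IHn]; first by move=> ?; exact: cvg_id.
exact: (continuousT_comp IHn cf).
Qed.

(** As [Y] is compact, joint continuity of [(x, y) |-> f x y] is the practical
    criterion for continuity into the homeomorphism group. *)
Lemma homeo_map_continuous (X : topologicalType) (Y : uniformType)
    (f : X -> homeo Y) : compact [set: Y] ->
  continuous (fun p : X * Y => f p.1 p.2) -> continuous f.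
Proof.
move=> cY cf x0 A [_ [[B oB <-] /= Bf BA]].
have /uniform_nbhs[E [entE EB]] : nbhs (f x0 : {uniform Y -> Y}) B.
  exact: open_nbhs_nbhs.
have nE : \forall x \near x0, forall y, E (f x0 y, f x y).
  apply: near_compactT => // y0.
  have /cvg_entourageP cfy := cf (x0, y0).
  have ent2 := entourage_split_ent entE.
  have /= [[A1 B1] /= [A1x B1y] AB1] := cfy _ ent2.
  have [[A2 B2] /= [A2x B2y] AB2] := cfy _ (entourage_inv ent2).
  exists (B1 `&` B2, A1) => /=; first by split => //; exact: filterI.
  move=> [y x] /= [[B1y' B2y'] A1x'].
  apply: (entourage_split (f x0 y0)) => //.
    by apply: (AB2 (x0, y)); split => //=; exact: nbhs_singleton.
  by apply: (AB1 (x, y)).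
by apply: filterS nE => x Ex; apply: BA; apply: EB => y _; exact: Ex.
Qed.

Section cocycle_topology.
Context {R : realType} {Z Y : pmetricType R}.
Variables (S : homeo Z) (GG : set (homeo Y)).
Implicit Types (G H : cocycles (Z := Z) GG).

Definition mk_cocycle (f : Z -> homeo Y) (cf : continuous f)
    (Gf : forall z, GG (f z)) : cocycles (Z := Z) GG :=
  @exist _ (fun f => f \in cocycles (Z := Z) GG) (f : {uniform Z -> homeo Y})
    (mem_set (conj cf Gf)).

(* The uniform structures involved are nested initial topologies; the next
   lemmas translate each of them into inequalities between distances. *)

Lemma homeo_nbhsP (g : homeo Y) (A : set (homeo Y)) :
  nbhs g A <-> exists2 e : R, 0 < e &
    forall h : homeo Y, (forall y, mdist (g y) (h y) < e) -> A h.
Proof.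
split.
  move=> [_ [[B oB <-] /= Bf BA]].
  have /uniform_nbhs[E [entE EB]] : nbhs (g : {uniform Y -> Y}) B.
    exact: open_nbhs_nbhs.
  move: entE; rewrite -entourage_ballE => -[e /= e0 eE].
  exists e => // h gh; apply: BA; apply: EB => y _; apply: eE => /=.
  by rewrite ballEmdist; exact: gh.
move=> [e e0 eA].
have : nbhs g [set h : homeo Y | forall y,
  [set xy : Y * Y | ball xy.1 e xy.2] (g y, h y)].
  by apply: homeo_near; exact: entourage_ball (PosNum e0).
by apply: filterS => h gh; apply: eA => y; have := gh y; rewrite /= ballEmdist.
Qed.

Lemma homeo_entourageP (E : set (homeo Y * homeo Y)) :
  entourage E <-> exists2 e : R, 0 < e &
    forall g h : homeo Y, (forall y, mdist (g y) (h y) < e) -> E (g, h).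
Proof.
split.
  move=> [B /= entB BE].
  move: entB; rewrite uniform_entourage => -[B' entB' B'B].
  move: entB'; rewrite -entourage_ballE => -[e /= e0 eE].
  exists e => // g h gh; apply: BE => /=; apply: B'B => /= y _; apply: eE => /=.
  by rewrite ballEmdist; exact: gh.
move=> [e e0 eE].
exists [set fg : (Y -> Y) * (Y -> Y) | forall y,
  [set: Y] y -> [set xy : Y * Y | ball xy.1 e xy.2] (fg.1 y, fg.2 y)].
  rewrite uniform_entourage; eexists; last by move=> ?; exact.
  exact: entourage_ball (PosNum e0).
move=> [g h] /= gh; apply: eE => y; have := gh y I.
by rewrite ballEmdist.
Qed.

Lemma cocycles_nbhsP G (A : set (cocycles (Z := Z) GG)) :
  nbhs G A <-> exists2 e : R, 0 < e &
    forall H, (forall z y, mdist (cocycle_fun G z y) (cocycle_fun H z y) < e)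
      -> A H.
Proof.
split.
  move=> [_ [[B oB <-] /= Bf BA]].
  have /uniform_nbhs[E [entE EB]] : nbhs (val G : {uniform Z -> homeo Y}) B.
    exact: open_nbhs_nbhs.
  move/homeo_entourageP : entE => [e e0 eE].
  exists e => // H GH; apply: BA; apply: EB => z _; apply: eE => y.
  exact: GH.
move=> [e e0 eA].
pose close := [set gh : homeo Y * homeo Y | forall y,
  mdist (gh.1 y) (gh.2 y) < e].
have := @initial_continuous (cocycles (Z := Z) GG) _ set_val G.
move=> /(_ [set f : {uniform Z -> homeo Y} | forall z, close (val G z, f z)]).
have nG : nbhs (val G : {uniform Z -> homeo Y})
    [set f : {uniform Z -> homeo Y} | forall z, close (val G z, f z)].
  apply/uniform_nbhs; exists close.
  split; first by apply/homeo_entourageP; exists e.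
  by move=> f Gf z; exact: (Gf z I).
move=> /(_ nG) nG'.
suff : nbhs G [set H | forall z y,
    mdist (cocycle_fun G z y) (cocycle_fun H z y) < e].
  by apply: filterS => H GH; apply: eA => z y; exact: GH.
exact: nG'.
Qed.

Local Notation Cob := (closure (coboundaries (Z := Z) GG S)).

Lemma cob_nbhsP (G : Cob) (A : set Cob) :
  nbhs G A <-> exists2 e : R, 0 < e &
    forall H : Cob, (forall z y,
      mdist (cocycle_fun (val G) z y) (cocycle_fun (val H) z y) < e) -> A H.
Proof.
split.
  move=> [_ [[B oB <-] /= Bf BA]].
  have /cocycles_nbhsP[e e0 eB] : nbhs (val G : cocycles (Z := Z) GG) B.
    exact: open_nbhs_nbhs.
  by exists e => // H GH; apply: BA; exact: eB.
move=> [e e0 eA].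
have := @initial_continuous Cob _ set_val G.
move=> /(_ [set H | forall z y,
      mdist (cocycle_fun (val G) z y) (cocycle_fun H z y) < e]).
have nG : nbhs (val G : cocycles (Z := Z) GG) [set H | forall z y,
      mdist (cocycle_fun (val G) z y) (cocycle_fun H z y) < e].
  by apply/cocycles_nbhsP; exists e.
move=> /(_ nG) nG'.
suff : nbhs G [set H : Cob | forall z y,
    mdist (cocycle_fun (val G) z y) (cocycle_fun (val H) z y) < e].
  by apply: filterS => H GH; exact: eA.
exact: nG'.
Qed.

Lemma near_coboundary (G : Cob) (e : R) : 0 < e ->
  exists H, coboundaries GG S H /\ forall z y,
      mdist (cocycle_fun (val G) z y) (cocycle_fun H z y) < e.
Proof.
move=> e0; have := set_valP G.
move=> /(_ [set H | forall z y,
      mdist (cocycle_fun (val G) z y) (cocycle_fun H z y) < e]).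
case; first by apply/cocycles_nbhsP; exists e.
by move=> H [cH HG]; exists H.
Qed.

End cocycle_topology.

(** * Distances and joint continuity *)

Section metric_facts.
Context {R : realType} {Y : pmetricType R}.

Lemma mdist_continuous : continuous (fun p : Y * Y => mdist p.1 p.2 : R).
Proof.
move=> [x y]; apply/(@cvgrPdist_lt R R^o) => e e0.
have e20 : 0 < e / 2 by rewrite divr_gt0.
exists (ball x (e / 2), ball y (e / 2)) => /=.
  by split; apply: nbhsx_ballx.
move=> [x' y'] /=; rewrite !ballEmdist /= => -[xx' yy'].
rewrite ltr_norml.
have := metric_triangle x x' y; have := metric_triangle x' y' y.
have := metric_triangle x' x y'; have := metric_triangle x y y'.
rewrite (metric_sym x' x) (metric_sym y' y).
by move: xx' yy'; lra.
Qed.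

Lemma mdist_comp_continuous (X : topologicalType) (f g : X -> Y) :
  continuous f -> continuous g -> continuous (fun x => mdist (f x) (g x) : R).
Proof.
move=> cf cg.
exact: (continuousT_comp (continuous_pairing cf cg) mdist_continuous).
Qed.

Lemma uniform_limit_continuous (X : topologicalType) (g : X -> Y) :
  (forall e : R, 0 < e -> exists2 f : X -> Y, continuous f &
     forall x, mdist (f x) (g x) <= e) ->
  continuous g.
Proof.
move=> fg x; apply/(cvgrPdist_lt (V := Y)) => e e0.
have e30 : 0 < e / 4 by rewrite divr_gt0.
have [f cf fge] := fg _ e30.
have /(cvgrPdist_lt (V := Y))/(_ _ e30) := cf x.
apply: filterS => x' ff'.
have := metric_triangle (g x) (f x) (g x').
have := metric_triangle (f x) (f x') (g x').
have := fge x; have := fge x'; rewrite (metric_sym (f x) (g x)).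
by move: ff'; lra.
Qed.

(** Any cluster point is such a limit, so that [e] need not tend to zero. *)
Lemma compact_cauchy_limit (u : nat -> Y) (e : nat -> R) :
  compact [set: Y] -> (forall n m, (n <= m)%N -> mdist (u n) (u m) <= e n) ->
  exists l, forall n, mdist (u n) l <= e n.
Proof.
move=> cY ue; have [l [_ clu]] := cY (u @ \oo) _ filterT.
exists l => n; apply/ler_addgt0Pl => d d0.
have [] := clu [set x | mdist (u n) x <= e n] (ball l d).
- by exists n => // m /= nm; exact: ue.
- exact: nbhsx_ballx.
move=> x [/= ux]; rewrite ballEmdist /= => lx.
have := metric_triangle (u n) x l; rewrite (metric_sym x l).
by move: ux lx; lra.
Qed.

End metric_facts.

Section homeo_families.
Context {R : realType} {Y : pmetricType R} {X : topologicalType}.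
Hypothesis cY : compact [set: Y].
Implicit Types f g : X -> homeo Y.

Lemma family_eval_continuous f : continuous f ->
  continuous (fun p : X * Y => f p.1 p.2).
Proof.
move=> cf; have c1 := continuousT_comp (@continuous_fst X Y) cf.
exact: (continuousT_comp (continuous_pairing c1 (@continuous_snd X Y))
  (@homeo_eval_continuous Y)).
Qed.

Lemma family_inv_eval_continuous f : continuous f ->
  continuous (fun p : X * Y => (f p.1)^-1%g p.2).
Proof.
move=> cf; have c1 := continuousT_comp (@continuous_fst X Y) cf.
exact: (continuousT_comp (continuous_pairing c1 (@continuous_snd X Y))
  (@homeo_eval_inv_continuous Y)).
Qed.

Lemma family_mul_continuous f g : continuous f -> continuous g ->
  continuous (fun x => (f x * g x)%g).
Proof.
move=> cf cg; apply: homeo_map_continuous => //.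
exact: (continuousT_comp
  (continuous_pairing (@continuous_fst X Y) (family_eval_continuous cg))
  (family_eval_continuous cf)).
Qed.

Lemma family_inv_continuous f : continuous f -> continuous (fun x =>
  (f x)^-1%g).
Proof.
move=> cf; apply: homeo_map_continuous => //; exact: family_inv_eval_continuous.
Qed.

(** Uniform equicontinuity of the fibre maps; only the second coordinate of
    the compact product moves, so that no metric on [X] is needed. *)
Lemma fiber_equicontinuous (F : X * Y -> Y) (e : R) :
  compact [set: X] -> continuous F -> 0 < e ->
  exists2 d : R, 0 < d & forall x y y', mdist y y' < d ->
    mdist (F (x, y)) (F (x, y')) < e.
Proof.
move=> cX cF e0; have cXY : compact [set: X * Y].
  by rewrite -setXTT; exact: compact_setX.
have : \forall d \near (0 : R)^'+, forall p : X * Y, forall y',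
  mdist p.2 y' < d ->
    mdist (F p) (F (p.1, y')) < e.
  apply: (@near_compactT (X * Y)%type _ (0 : R)^'+ (fun d p => forall y',
    mdist p.2 y' < d -> mdist (F p) (F (p.1, y')) < e) _ cXY) => -[x y].
  have e20 : 0 < e / 2 by rewrite divr_gt0.
  have /(cvgrPdist_lt (V := Y))/(_ _ e20)[[A B] /= [nA +] AB] := cF (x, y).
  rewrite -nbhs_ballE => -[r /= r0 rB].
  exists (A `*` ball y (r / 2), [set d | d < r / 2]).
    split => /=; last by apply: nbhs_right_lt; rewrite divr_gt0.
    exists (A, ball y (r / 2)) => //=; split => //.
    by apply: nbhsx_ballx; rewrite divr_gt0.
  move=> [[x' y'] d] /= [[Ax' +] dr] y'' y'd; rewrite ballEmdist /= => yy'.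
  have h1 : mdist (F (x, y)) (F (x', y')) < e / 2.
    by apply: (AB (x', y')); split => //; apply: rB; rewrite ballEmdist /=; lra.
  have h2 : mdist (F (x, y)) (F (x', y'')) < e / 2.
    apply: (AB (x', y'')); split => //; apply: rB; rewrite ballEmdist /=.
    by have := metric_triangle y y' y''; lra.
  have := metric_triangle (F (x', y')) (F (x, y)) (F (x', y'')).
  by rewrite (metric_sym (F (x', y')) (F (x, y))); lra.
move=> nd; have [d [dP d0]] := filter_ex (filterI nd (nbhs_right_gt (0 : R))).
by exists d => // x y y' yy'; exact: (dP (x, y)).
Qed.

Lemma compact_bounded_dist : exists2 B : R, 0 < B & forall y y' : Y,
  mdist y y' <= B.
Proof.
have : \forall B \near +oo%R, forall y : Y, mdist point y < B.
  apply: (@near_compactT Y R +oo%R (fun B y => mdist point y < B) _ cY) => y.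
  exists (ball y 1, [set B | mdist point y + 1 < B]) => /=.
    by split; [exact: nbhsx_ballx | exact: nbhs_pinfty_gt (num_real _)].
  move=> [y' B] /=; rewrite ballEmdist /= => -[yy' yB].
  by have := metric_triangle point y y'; lra.
move=> nB; have [B [BP B0]] := filter_ex (filterI nB (nbhs_pinfty_gt (num_real
  (0 : R)))).
exists (B + B); first by rewrite addr_gt0.
move=> y y'; have := metric_triangle y point y'.
by have := BP y; have := BP y'; rewrite (metric_sym y point) /=; lra.
Qed.

End homeo_families.

Lemma expgn_homeoE (X : topologicalType) (T : homeo X) n x :
  (T ^+ n)%g x = iter n T x.
Proof.
elim: n x => [|n IHn] x; first by rewrite expg0.
by rewrite expgS /= -IHn.
Qed.

Section joint_continuity.
Context {R : realType} {Z Y : pmetricType R}.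
Variables (S : homeo Z) (GG : set (homeo Y)).
Local Notation Cob := (closure (coboundaries (Z := Z) GG S)).

Lemma cob_fun_continuous :
  continuous (fun p : Cob * Z => cocycle_fun (val p.1) p.2).
Proof.
move=> [G z] A /homeo_nbhsP[e e0 eA].
have e20 : 0 < e / 2 by rewrite divr_gt0.
exists ([set H : Cob | forall z y,
      mdist (cocycle_fun (val G) z y) (cocycle_fun (val H) z y) < e / 2],
   [set z' | forall y,
      mdist (cocycle_fun (val G) z y) (cocycle_fun (val G) z' y) < e / 2]) =>
        /=.
  split; first by apply/cob_nbhsP; exists (e / 2).
  have := @cocycle_continuous _ _ _ (val G) z.
  move=> /(_ [set h : homeo Y | forall y,
    mdist (cocycle_fun (val G) z y) (h y) < e / 2]).
  by apply; apply/homeo_nbhsP; exists (e / 2).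
move=> [H z'] /= [GH zz']; apply: eA => y.
have := metric_triangle (cocycle_fun (val G) z y) (cocycle_fun (val G) z' y)
  (cocycle_fun (val H) z' y).
by have := GH z' y; have := zz' y; lra.
Qed.

Lemma continuous_regroup (A B C : topologicalType) :
  continuous (fun p : A * (B * C) => ((p.1, p.2.1), p.2.2)).
Proof.
have c1 := @continuous_fst A (B * C)%type.
have c2 := @continuous_snd A (B * C)%type.
have c21 := continuousT_comp c2 (@continuous_fst B C).
have c22 := continuousT_comp c2 (@continuous_snd B C).
exact: (continuous_pairing (continuous_pairing c1 c21) c22).
Qed.

Lemma cob_eval_continuous :
  continuous (fun p : Cob * (Z * Y) => cocycle_fun (val p.1) p.2.1 p.2.2).
Proof.
exact: (continuousT_comp (@continuous_regroup Cob Z Y)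
  (family_eval_continuous cob_fun_continuous)).
Qed.

Lemma cob_eval_inv_continuous : continuous
  (fun p : Cob * (Z * Y) => (cocycle_fun (val p.1) p.2.1)^-1%g p.2.2).
Proof.
exact: (continuousT_comp (@continuous_regroup Cob Z Y)
  (family_inv_eval_continuous cob_fun_continuous)).
Qed.

Lemma cob_iter_continuous n :
  continuous (fun p : Cob * (Z * Y) => iter n (skew_product S (val p.1)) p.2).
Proof.
have cf := @continuous_fst Cob (Z * Y)%type.
have cs := @continuous_snd Cob (Z * Y)%type.
elim: n => [|n IHn]; first exact: cs.
have c1 : continuous (fun p : Cob * (Z * Y) =>
    (S p.2.1, cocycle_fun (val p.1) p.2.1 p.2.2)).
  apply: continuous_pairing; last exact: cob_eval_continuous.
  exact: (continuousT_comp (continuousT_comp cs (@continuous_fst Z Y))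
    (@homeo_fun_continuous _ S)).
exact: (continuousT_comp (continuous_pairing cf IHn) c1).
Qed.

End joint_continuity.

(** * The Baire property *)

Section baire.
Context {R : realType} {Z Y : pmetricType R}.
Variables (S : homeo Z) (GG : set (homeo Y)).
Hypotheses (cZ : compact [set: Z]) (cY : compact [set: Y]) (clGG : closed GG).
Local Notation Cob := (closure (coboundaries (Z := Z) GG S)).

(** The uniform distance on the homeomorphism group is not complete; the
    distance that also compares the inverses is, and gives the same topology. *)
Definition two_sided_ball (H : Cob) (e : R) : set Cob :=
  [set H' | forall z y,
    mdist (cocycle_fun (val H) z y) (cocycle_fun (val H') z y) <= e /\
    mdist ((cocycle_fun (val H) z)^-1%g y) ((cocycle_fun (val H') z)^-1%g y)
      <= e].

Lemma two_sided_ball_nbhs (H : Cob) (e : R) : 0 < e ->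
  nbhs H (two_sided_ball H e).
Proof.
move=> e0; have cX : compact [set: Z * Y].
  by rewrite -setXTT; exact: compact_setX.
have cf : continuous (fun p : Cob * (Z * Y) => (H, p.2)).
  by apply: continuous_pairing => ?; [exact: cvg_cst | exact: cvg_snd].
have near_le (F : Cob * (Z * Y) -> Y) : continuous F ->
    \forall H' \near H, forall x, mdist (F (H, x)) (F (H', x)) <= e.
  move=> cF; apply: (@near_compactT (Z * Y)%type _ (nbhs H) (fun H' x =>
    mdist (F (H, x)) (F (H', x)) <= e) _ cX) => x.
  have := mdist_comp_continuous (continuousT_comp cf cF) cF.
  move=> /(_ (H, x))/(cvgrPdist_lt (V := R^o))/(_ _ e0) /=.
  rewrite mdistxx => -[[A B] /= [HA xB] AB].
  exists (B, A) => //= -[x' H'] /= [Bx' AH'].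
  have := AB (H', x') (conj AH' Bx'); rewrite /= /mdist /= subr0.
  by rewrite ger0_norm ?mdist_ge0// => /ltW.
have n1 := near_le _ (@cob_eval_continuous R Z Y S GG).
have n2 := near_le _ (@cob_eval_inv_continuous R Z Y S GG).
apply: (@filterS _ (nbhs H) _ _ _ _ (filterI n1 n2)) => H' [H1 H2] z y.
by split; [exact: (H1 (z, y)) | exact: (H2 (z, y))].
Qed.

Lemma nbhs_two_sided_ball (H : Cob) (A : set Cob) : nbhs H A ->
  exists2 e : R, 0 < e & two_sided_ball H e `<=` A.
Proof.
move=> /cob_nbhsP[e e0 eA]; exists (e / 2); first by rewrite divr_gt0.
move=> H' HH'; apply: eA => z y; have [] := HH' z y.
by move=> /le_lt_trans + _; apply; lra.
Qed.

(** The limit of the inverses inverts the limit: in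
    [h' (f_n y) -> h' (h y)] the left-hand side stays within [e n] of
    [f_n^-1 (f_n y) = y]. *)
Lemma two_sided_complete (H : nat -> Cob) (e : nat -> R) :
  (forall d : R, 0 < d -> exists n, e n <= d) ->
  (forall n m, (n <= m)%N -> two_sided_ball (H n) (e n) (H m)) ->
  exists K : Cob, forall n, two_sided_ball (H n) (e n) K.
Proof.
move=> e0 HH.
have lim_ex (F : Cob -> Z * Y -> Y) : (forall n m, (n <= m)%N -> forall x,
    mdist (F (H n) x) (F (H m) x) <= e n) ->
    exists g : Z * Y -> Y, forall x n, mdist (F (H n) x) (g x) <= e n.
  move=> FH; suff /choice[g] : forall x, exists l, forall n,
      mdist (F (H n) x) l <= e n by exists g.
  by move=> x; apply: compact_cauchy_limit => // n m nm; exact: FH.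
pose F1 (G : Cob) (x : Z * Y) := cocycle_fun (val G) x.1 x.2.
pose F2 (G : Cob) (x : Z * Y) := (cocycle_fun (val G) x.1)^-1%g x.2.
have [g Hg] : exists g : Z * Y -> Y, forall x n,
  mdist (F1 (H n) x) (g x) <= e n.
  by apply: lim_ex => n m nm [z y]; have [] := HH n m nm z y.
have [g' Hg'] : exists g : Z * Y -> Y, forall x n,
  mdist (F2 (H n) x) (g x) <= e n.
  by apply: lim_ex => n m nm [z y]; have [] := HH n m nm z y.
have cst n : continuous (fun x : Z * Y => (H n, x)).
  by apply: continuous_pairing => ?; [exact: cvg_cst | exact: cvg_id].
have cg : continuous g.
  apply: uniform_limit_continuous => d /e0[n end_].
  exists (F1 (H n)); last by move=> x; exact: le_trans (Hg x n) end_.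
  exact: (continuousT_comp (cst n) (@cob_eval_continuous R Z Y S GG)).
have cg' : continuous g'.
  apply: uniform_limit_continuous => d /e0[n end_].
  exists (F2 (H n)); last by move=> x; exact: le_trans (Hg' x n) end_.
  exact: (continuousT_comp (cst n) (@cob_eval_inv_continuous R Z Y S GG)).
have can_lim (f f' : Cob -> Z * Y -> Y) (h h' : Z * Y -> Y) :
    (forall G z, cancel (fun y => f G (z, y)) (fun y => f' G (z, y))) ->
    (forall x n, mdist (f (H n) x) (h x) <= e n) ->
    (forall x n, mdist (f' (H n) x) (h' x) <= e n) ->
    continuous h' -> forall z, cancel (fun y => h (z, y)) (fun y => h' (z, y)).
  move=> ff' fh fh' ch' z y /=; apply/eqP; rewrite -[_ == _]negbK -mdist_gt0.
  apply/negP => d0.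
  set D := mdist (h' (z, h (z, y))) y in d0.
  have D20 : 0 < D / 2 by rewrite divr_gt0.
  have /(cvgrPdist_lt (V := Y))/(_ _ D20) := ch' (z, h (z, y)).
  move=> [[A B] /= [Az +] AB]; rewrite -nbhs_ballE => -[r /= r0 rB].
  have dr : 0 < Num.min (r / 2) (D / 2) by rewrite lt_min !divr_gt0.
  have [n] := e0 _ dr; rewrite le_min => /andP[er eD].
  have yn : ball (h (z, y)) r (f (H n) (z, y)).
    rewrite ballEmdist /= metric_sym (le_lt_trans (fh _ _))//.
    by rewrite (le_lt_trans er)//; lra.
  have := AB (z, f (H n) (z, y)) (conj (nbhs_singleton Az) (rB _ yn)).
  have := fh' (z, f (H n) (z, y)) n; rewrite ff' /= metric_sym => h1 h2.
  have := metric_triangle (h' (z, h (z, y))) (h' (z, f (H n) (z, y))) y.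
  by rewrite -/D; move: h1 h2 eD; lra.
have gg' z : cancel (fun y => g (z, y)) (fun y => g' (z, y)).
  apply: (can_lim F1 F2) => // G z' y; exact: homeo_funK.
have g'g z : cancel (fun y => g' (z, y)) (fun y => g (z, y)).
  apply: (can_lim F2 F1) => // G z' y; exact: homeo_invK.
have cz (z : Z) : continuous (fun y : Y => (z, y)).
  have c1 : continuous (fun _ : Y => z) by move=> ?; exact: cvg_cst.
  have c2 : continuous (fun y : Y => y) by move=> ?; exact: cvg_id.
  exact: (continuous_pairing c1 c2).
pose K0 z := Homeo (gg' z) (g'g z) (continuousT_comp (cz z) cg)
  (continuousT_comp (cz z) cg').
have cK0 : continuous K0.
  apply: homeo_map_continuous => //=.
  have -> : (fun p : Z * Y => g (p.1, p.2)) = g by apply/funext => -[].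
  exact: cg.
have GK0 z : GG (K0 z).
  apply: clGG => A /homeo_nbhsP[d d0 dA].
  have d20 : 0 < d / 2 by rewrite divr_gt0.
  have [n en] := e0 _ d20.
  exists (cocycle_fun (val (H n)) z); split.
    by have [_] := set_valP (val (H n)); apply.
  apply: dA => y; rewrite metric_sym.
  by rewrite (le_lt_trans (Hg (z, y) n))// (le_lt_trans en)//; lra.
pose K2 := mk_cocycle cK0 GK0.
have K3 : Cob K2.
  apply: (@closed_closure _ (coboundaries (Z := Z) GG S)).
  move=> A /cocycles_nbhsP[d d0 dA].
  have d20 : 0 < d / 2 by rewrite divr_gt0.
  have [n en] := e0 _ d20.
  exists (val (H n)); split; first exact: set_valP.
  apply: dA => z y; rewrite metric_sym.
  by rewrite (le_lt_trans (Hg (z, y) n))// (le_lt_trans en)//; lra.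
pose K : Cob := @exist _ (fun G => G \in Cob) K2 (mem_set K3).
by exists K => n z y; split; [exact: (Hg (z, y) n) | exact: (Hg' (z, y) n)].
Qed.

(** Baire's theorem: the centres of nested two-sided balls, each contained in
    the next dense open set, converge. *)
Lemma cob_baire (D : nat -> set Cob) :
  (forall n, open (D n)) -> (forall n, dense (D n)) -> dense (\bigcap_n D n).
Proof.
move=> oD dD O [H0 OH0] oO.
have [e00 e00_gt0 e0O] := nbhs_two_sided_ball (open_nbhs_nbhs (conj oO OH0)).
have step (nc : nat * (Cob * R)) : exists c' : Cob * R, 0 < nc.2.2 ->
    [/\ 0 < c'.2, c'.2 <= nc.2.2 / 2,
        two_sided_ball c'.1 c'.2 `<=` D nc.1 &
        two_sided_ball c'.1 c'.2 `<=` two_sided_ball nc.2.1 nc.2.2].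
  case: nc => n [H e] /=; have [e0|] := ltP 0 e; last by exists (H, e).
  have nH := two_sided_ball_nbhs H e0.
  have [H' [H'i H'D]] : (two_sided_ball H e)° `&` D n !=set0.
    apply: dD; last exact: open_interior.
    by exists H; exact: nH.
  have : nbhs H' ((two_sided_ball H e) `&` D n).
    by apply: filterI => //; exact: open_nbhs_nbhs.
  move=> /nbhs_two_sided_ball[e' e'0 e'P].
  exists (H', Num.min e' (e / 2)) => _ /=.
  have sub : two_sided_ball H' (Num.min e' (e / 2)) `<=` two_sided_ball H' e'.
    move=> K HK z y; have [h1 h2] := HK z y.
    by split; [apply: le_trans h1 _ | apply: le_trans h2 _];
      rewrite ge_min lexx.
  split.
  - by rewrite lt_min e'0 divr_gt0.
  - by rewrite ge_min lexx orbT.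
  - by move=> K /sub/e'P[].
  - by move=> K /sub/e'P[].
have [f Hf] := @choice _ _ _ step.
pose s := fix s n := if n is n'.+1 then f (n', s n') else (H0, e00).
have s0 n : 0 < (s n).2.
  by elim: n => [//|n IHn] /=; have [] := Hf (n, s n) IHn.
have sP n := Hf (n, s n) (s0 n).
have sdec n m : (n <= m)%N ->
    two_sided_ball (s m).1 (s m).2 `<=` two_sided_ball (s n).1 (s n).2.
  elim: m => [|m IHm]; first by rewrite leqn0 => /eqP ->.
  rewrite leq_eqVlt => /orP[/eqP -> //|/IHm nm].
  by apply: subset_trans nm; have [] := sP m.
have center n : two_sided_ball (s n).1 (s n).2 (s n).1.
  by move=> z y; rewrite !mdistxx (ltW (s0 n)).
have spow n : (s n).2 <= e00 / n.+1%:R.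
  elim: n => [|n IHn]; first by rewrite divr1.
  have [_ + _ _] := sP n => /le_trans; apply; rewrite -/(s n) /=.
  rewrite (@le_trans _ _ (e00 / n.+1%:R / 2))//; first by rewrite ler_pM2r.
  rewrite -mulrA -invfM ler_pM2l// lef_pV2 ?posrE ?mulr_gt0// -natrM ler_nat.
  by lia.
have elim d : 0 < d -> exists n, (s n).2 <= d.
  move=> d0; exists (Num.truncn (e00 / d)); apply: le_trans (spow _) _.
  rewrite ler_pdivrMr// mulrC -ler_pdivrMr//.
  by rewrite ltW// truncnS_gt.
have [K HK] := @two_sided_complete (fun n => (s n).1) (fun n => (s n).2)
  elim (fun n m nm => sdec n m nm _ (center m)).
exists K; split; first by apply: e0O; exact: (HK 0%N).
by move=> n _; have [_ _ + _] := sP n; apply; exact: (HK n.+1).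
Qed.

End baire.

(** * The two open conditions *)

Lemma sum_continuous (R : realType) (X : topologicalType) (f : nat -> X -> R)
  n :
  (forall i, continuous (f i)) -> continuous (fun x => \sum_(i < n) f i x).
Proof.
move=> cf; elim: n => [|n IHn].
  under eq_fun do rewrite big_ord0.
  by move=> x; exact: cvg_cst.
under eq_fun do rewrite big_ord_recr /=.
by move=> x; apply: cvgD; [exact: IHn | exact: cf].
Qed.

Section open_conditions.
Context {R : realType} {Z Y : pmetricType R}.
Variables (S : homeo Z) (GG : set (homeo Y)).
Hypotheses (cZ : compact [set: Z]) (cY : compact [set: Y]).
Local Notation Cob := (closure (coboundaries (Z := Z) GG S)).

Definition visits (U : set (Z * Y)) (G : cocycles (Z := Z) GG) :=
  exists N, forall x, exists2 n, (n < N)%N & U (iter n (skew_product S G) x).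

Definition mean_contracting (e : R) (G : cocycles (Z := Z) GG) :=
  exists2 N, (0 < N)%N & forall z y1 y2,
    \sum_(n < N) mdist (iter n (skew_product S G) (z, y1)).2
                       (iter n (skew_product S G) (z, y2)).2 < e * N%:R.

Lemma open_visits (U : set (Z * Y)) : open U ->
  open [set G : Cob | visits U (val G)].
Proof.
move=> oU; rewrite openE => G [N GN].
have cX : compact [set: Z * Y] by rewrite -setXTT; exact: compact_setX.
have nG : \forall H \near G, forall x,
    exists2 n, (n < N)%N & U (iter n (skew_product S (val H)) x).
  apply: (@near_compactT (Z * Y)%type _ (nbhs G) (fun H x =>
    exists2 n, (n < N)%N & U (iter n (skew_product S (val H)) x)) _ cX) => x.
  have [n nN Un] := GN x.
  have := @cob_iter_continuous R Z Y S GG n (G,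
    x) U (open_nbhs_nbhs (conj oU Un)).
  move=> [[A B] /= [GA xB] AB]; exists (B, A) => //= -[x' H'] /= [Bx' AH'].
  by exists n => //; exact: (AB (H', x')).
by apply: (@filterS _ (nbhs G) _ _ _ _ nG) => H HN; exists N.
Qed.

Lemma open_mean_contracting (e : R) :
  open [set G : Cob | mean_contracting e (val G)].
Proof.
rewrite openE => G [N N0 GN].
have cX : compact [set: Z * (Y * Y)].
  by rewrite -!setXTT; apply: compact_setX => //; exact: compact_setX.
pose F (p : Cob * (Z * (Y * Y))) : R :=
  \sum_(n < N) mdist (iter n (skew_product S (val p.1)) (p.2.1, p.2.2.1)).2
                     (iter n (skew_product S (val p.1)) (p.2.1, p.2.2.2)).2.
have cF : continuous F.
  apply: (@sum_continuous R (Cob * (Z * (Y * Y)))%type (fun n p =>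
    mdist (iter n (skew_product S (val p.1)) (p.2.1, p.2.2.1)).2
          (iter n (skew_product S (val p.1)) (p.2.1, p.2.2.2)).2)) => n.
  have cf := @continuous_fst Cob (Z * (Y * Y))%type.
  have cs := @continuous_snd Cob (Z * (Y * Y))%type.
  have csf := continuousT_comp cs (@continuous_fst Z (Y * Y)%type).
  have css := continuousT_comp cs (@continuous_snd Z (Y * Y)%type).
  have c1 := continuousT_comp css (@continuous_fst Y Y).
  have c2 := continuousT_comp css (@continuous_snd Y Y).
  have csnd := @continuous_snd Z Y.
  have ci := @cob_iter_continuous R Z Y S GG n.
  have d1 := continuousT_comp (continuousT_comp
    (continuous_pairing cf (continuous_pairing csf c1)) ci) csnd.
  have d2 := continuousT_comp (continuousT_comp
    (continuous_pairing cf (continuous_pairing csf c2)) ci) csnd.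
  exact: (mdist_comp_continuous d1 d2).
have nG : \forall H \near G, forall x, F (H, x) < e * N%:R.
  apply: (@near_compactT (Z * (Y * Y))%type _ (nbhs G)
    (fun H x => F (H, x) < e * N%:R) _ cX) => x.
  have /(cvgr_lt (F (G, x)))/(_ (e * N%:R)) := cF (G, x).
  move=> []; first by case: x => z [y1 y2]; exact: GN.
  move=> [A B] /= [GA xB] AB; exists (B, A) => //= -[x' H'] /= [Bx' AH'].
  exact: (AB (H', x')).
apply: (@filterS _ (nbhs G) _ _ _ _ nG) => H HN; exists N => // z y1 y2.
exact: (HN (z, (y1, y2))).
Qed.

Lemma near_iter (G : Cob) (N : nat) (e : R) : 0 < e ->
  \forall H \near G, forall x n, (n <= N)%N ->
    mdist (iter n (skew_product S (val H)) x).2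
          (iter n (skew_product S (val G)) x).2 < e.
Proof.
move=> e0; have cX : compact [set: Z * Y].
  by rewrite -setXTT; exact: compact_setX.
have one n : \forall H \near G, forall x,
    mdist (iter n (skew_product S (val H)) x).2
          (iter n (skew_product S (val G)) x).2 < e.
  apply: (@near_compactT (Z * Y)%type _ (nbhs G) (fun H x =>
    mdist (iter n (skew_product S (val H)) x).2
          (iter n (skew_product S (val G)) x).2 < e) _ cX) => x.
  have csnd := @continuous_snd Z Y.
  have cs := @continuous_snd Cob (Z * Y)%type.
  have ci := @cob_iter_continuous R Z Y S GG n.
  have c0 : continuous (fun _ : Cob * (Z * Y) => G) by move=> ?; exact: cvg_cst.
  have := mdist_comp_continuous (continuousT_comp ci csnd)
    (continuousT_comp (continuousT_comp (continuous_pairing c0 cs) ci) csnd).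
  move=> /(_ (G, x))/(cvgr_lt (mdist (iter n (skew_product S (val G)) x).2
    (iter n (skew_product S (val G)) x).2 : R))/(_ e).
  rewrite mdistxx => -[//|[A B] /= [GA xB] AB].
  exists (B, A) => //= -[x' H'] /= [Bx' AH']; exact: (AB (H', x')).
elim: N => [|N IHN].
  apply: (@filterS _ (nbhs G) _ _ _ _ (one 0%N)) => H H0 x n.
  by rewrite leqn0 => /eqP ->.
apply: (@filterS _ (nbhs G) _ _ _ _ (filterI IHN (one N.+1))) => H [H0 H1] x n.
by rewrite leq_eqVlt => /orP[/eqP ->|]; [exact: H1 | rewrite ltnS; exact: H0].
Qed.

End open_conditions.

(** * Borel measures and orbit averages *)

Lemma open_borel (X : ptopologicalType) (U : set (borel X)) :
  @open X U -> measurable U.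
Proof. by move=> oU; exact: sub_sigma_algebra. Qed.

Lemma borel_measurable_fun d (T : measurableType d) (X : ptopologicalType)
    (f : T -> borel X) : (forall U, @open X U -> measurable (f @^-1` U)) ->
  measurable_fun setT f.
Proof.
move=> fU; apply: (@measurability _ _ T (borel X) setT f (@open X) erefl) =>
  _ [U oU <-].
by rewrite setTI; exact: fU.
Qed.

Lemma continuous_borel (X X' : ptopologicalType) (f : X -> X') :
  continuous f -> measurable_fun setT (f : borel X -> borel X').
Proof.
move=> /continuousP cf; apply: borel_measurable_fun => U oU.
by apply: open_borel; exact: cf.
Qed.

Lemma continuous_real_borel (R : realType) (X : ptopologicalType) (f : X -> R) :
  continuous f -> measurable_fun setT (f : borel X -> R).
Proof.
move=> /continuousP cf; apply: (measurability _ (RGenOpens.measurableE R)).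
move=> _ [_ [a [b ->] <-]]; rewrite setTI; apply: open_borel; apply: cf.
exact: interval_open.
Qed.

Lemma countable_bigcup_measurable d (T : measurableType d) (I : choiceType) (D
  : set I)
    (F : I -> set T) :
  countable D -> (forall i, D i -> measurable (F i)) ->
  measurable (\bigcup_(i in D) F i).
Proof.
move=> cD mF; rewrite bigcup_set_type; apply: countable_bigcupT_measurable.
  by rewrite (eq_countable (card_setT _)).
by move=> i; apply: mF; exact: set_valP.
Qed.

(** A pointwise limit lies in the open set [U] if and only if the sequence is
    eventually in some basic open set whose closure is contained in [U]. *)
Lemma measurable_pointwise_limit d (T : measurableType d) (X : ptopologicalType)
    (f : nat -> T -> X) (g : T -> X) :
  @second_countable X -> regular_space X ->
  (forall k, measurable_fun setT (f k : T -> borel X)) ->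
  (forall x, f k x @[k --> \oo] --> g x) ->
  measurable_fun setT (g : T -> borel X).
Proof.
move=> [B cB [oB bB]] rX mf fg; apply: borel_measurable_fun => U oU.
have -> : g @^-1` U = \bigcup_(W in [set W | B W /\ closure W `<=` U])
    \bigcup_n \bigcap_(k in [set k | (n <= k)%N]) (f k @^-1` W).
  apply/seteqP; split => x /=.
    move=> Ugx; have : filter_from (nbhs (g x)) closure U.
      by apply: rX; exact: open_nbhs_nbhs.
    move=> [V nV VU]; have [W [BW Wgx] WV] := bB _ _ nV.
    have nW : nbhs (g x) W by apply: open_nbhs_nbhs; split => //; exact: oB.
    have [n _ nP] := fg x W nW.
    exists W; first by split => //; apply: subset_trans VU;
      exact: closure_subset.
    by exists n => // k /= nk; exact: nP.
  move=> [W [BW WU] [n _ nP]]; apply: WU => V nV.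
  have [m _ mP] := fg x V nV.
  exists (f (maxn n m) x); split; first by apply: (nP (maxn n m));
    exact: leq_maxl.
  by apply: mP => /=; exact: leq_maxr.
apply: countable_bigcup_measurable; first by apply: sub_countable cB;
  apply: subset_card_le => W [].
move=> W [BW _]; apply: bigcupT_measurable => n; apply: bigcap_measurableType.
move=> k _; rewrite -[X in measurable X]setTI; apply: mf => //.
by apply: open_borel; exact: oB.
Qed.

Lemma integral_invariant (R : realType) (X : ptopologicalType) (T : homeo X)
    (mu : probability (borel X) R) (F : X -> R) n :
  invariant_measure T mu -> continuous F -> (forall x, 0 <= F x) ->
  (\int[mu]_x (F (iter n T x))%:E = \int[mu]_x (F x)%:E)%E.
Proof.
move=> Tmu cF F0; elim: n => [//|n IHn].
rewrite -[RHS]IHn.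
have cT := @homeo_fun_continuous _ T.
have citer : continuous (iter n T) by exact: iter_continuous.
have cFn : continuous (fun x => F (iter n T x)).
  exact: (continuousT_comp citer cF).
have mT : measurable_fun setT (T : borel X -> borel X).
  exact: continuous_borel.
transitivity (\int[pushforward mu (T : borel X -> borel X)]_x (F (iter n T
  x))%:E)%E.
  rewrite ge0_integral_pushforward//.
  - by rewrite preimage_setT; apply: eq_integral => x _; rewrite /= -iterSr.
  - by apply/measurable_EFinP; exact: continuous_real_borel.
  - by move=> x _; rewrite lee_fin.
by apply: eq_measure_integral => A mA _; exact: Tmu.
Qed.

(** The mean of [F] is the mean of its orbit averages. *)
Lemma integral_le_orbit_average (R : realType) (X : ptopologicalType)
    (T : homeo X) (mu : probability (borel X) R) (F : X -> R) (c : R) N :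
  invariant_measure T mu -> continuous F -> (forall x, 0 <= F x) ->
  (0 < N)%N -> (forall x, \sum_(n < N) F (iter n T x) <= c * N%:R) ->
  (\int[mu]_x (F x)%:E <= c%:E)%E.
Proof.
move=> Tmu cF F0 N0 FN.
have cT := @homeo_fun_continuous _ T.
have mF k : measurable_fun setT (fun x : borel X => (F (iter k T x))%:E).
  apply/measurable_EFinP; apply: continuous_real_borel.
  have citer : continuous (iter k T) by exact: iter_continuous.
  exact: (continuousT_comp citer cF).
have : (\int[mu]_x (\sum_(n < N) (F (iter n T x))%:E) <=
    \int[mu]_x (cst (c * N%:R)%:E) x)%E.
  apply: ge0_le_integral => //.
  - by move=> x _; apply: sume_ge0 => n _; rewrite lee_fin.
  - exact: emeasurable_sum.
  - by move=> x _; rewrite sumEFin lee_fin.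
rewrite integral_cst//= [mu _]probability_setT mule1 ge0_integral_sum//.
under eq_bigr do rewrite integral_invariant//.
set I := (\int[mu]_x _)%E.
have -> : (\sum_(i < N) I = N%:R%:E * I)%E.
  have I0 : (0 <= I)%E by apply: integral_ge0 => x _; rewrite lee_fin.
  elim: (N) => [|n IHn]; first by rewrite big_ord0 mul0e.
  rewrite big_ord_recr /= IHn -natr1 EFinD ge0_muleDl ?lee_fin//.
  by rewrite mul1e.
rewrite mulrC EFinM lee_pmul2l//.
by rewrite lte_fin ltr0n.
Unshelve. all: by move=> *; rewrite lee_fin; exact: F0.
Qed.

(** The bounds are summable, hence so are the functions almost everywhere. *)
Lemma summable_ae d (T : measurableType d) (R : realType)
    (mu : {measure set T -> \bar R}) (F : nat -> T -> R) (c : R) :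
  0 <= c ->
  (forall k, measurable_fun setT (F k)) -> (forall k x, 0 <= F k x) ->
  (forall k, (\int[mu]_x (F k x)%:E <= (c / (2 ^ k.+1)%:R)%:E)%E) ->
  measurable [set x | (\sum_(k <oo) (F k x)%:E < +oo)%E] /\
  mu (~` [set x | (\sum_(k <oo) (F k x)%:E < +oo)%E]) = 0%E.
Proof.
move=> c0 mF F0 Fc.
have mEF k : measurable_fun setT (fun x => (F k x)%:E).
  by apply/measurable_EFinP.
have mS : measurable_fun setT (fun x => \sum_(k <oo) (F k x)%:E)%E.
  by apply: ge0_emeasurable_sum => // k x _ _; rewrite lee_fin.
set A := [set x | _].
have mA : measurable A.
  have := emeasurable_fun_infty_o measurableT mS +oo%E.
  by rewrite setTI.
split => //.
have S0 x : (0 <= \sum_(k <oo) (F k x)%:E)%E.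
  by apply: nneseries_ge0 => k _ _; rewrite lee_fin.
have fin : (\int[mu]_x (\sum_(k <oo) (F k x)%:E) < +oo)%E.
  rewrite integral_nneseries//; last by move=> k x _; rewrite lee_fin.
  apply: (@le_lt_trans _ _ (\sum_(k <oo) (c / (2 ^ k.+1)%:R)%:E)%E).
    apply: lee_nneseries => k *; last exact: Fc.
    by apply: integral_ge0 => x _; rewrite lee_fin.
  by apply: le_lt_trans (ltry c); exact: epsilon_trick0.
have intS : mu.-integrable setT (fun x => \sum_(k <oo) (F k x)%:E)%E.
  apply/integrableP; split => //.
  by under eq_integral do rewrite gee0_abs//.
have [N [mN N0 AN]] := integrable_ae measurableT intS.
apply/eqP; rewrite -measure_le0 -N0; apply: le_measure; rewrite ?inE//.
  exact: measurableC.
move=> x Ax; apply: AN => /= /(_ I) fx; apply: Ax.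
by rewrite /A /= ltey_eq fx.
Qed.

(** * Invariant measures carried by a graph *)

(* The pointed pseudometric structure under which a compact product is second
   countable. *)
HB.instance Definition _ (R : realType) (Z Y : pseudoPMetricType R) :=
  Pointed.on (Z * Y)%type.

Lemma prod_second_countable (R : realType) (Z Y : pmetricType R) :
  compact [set: Z] -> compact [set: Y] -> @second_countable (Z * Y)%type.
Proof.
move=> cZ cY; apply: (@compact_second_countable R (Z * Y)%type).
by rewrite -setXTT; exact: compact_setX.
Qed.

Lemma nneseries_tail_le (R : realType) (a : nat -> R) (e : R) :
  (forall k, 0 <= a k) -> (\sum_(k <oo) (a k)%:E < +oo)%E -> 0 < e ->
  exists n, forall m p, (n <= m)%N -> \sum_(m <= i < p) a i <= e.
Proof.
move=> a0 aoo e0; have := @nneseries_tail_cvg R (fun k => (a k)%:E) xpredT aoo.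
move=> /(_ (fun k _ => ltac:(rewrite lee_fin; exact: a0))) /fine_cvgP[fin].
move=> /(cvgrPdist_le (V := R^o))/(_ _ e0) H.
have [n _ nP] := filterI fin H.
exists n => m p nm; have /= [mfin] := nP m nm.
rewrite /mdist /= subr0 ger0_norm; last first.
  by apply: fine_ge0; apply: nneseries_ge0 => k _ _; rewrite lee_fin.
rewrite -lee_fin fineK// => h; rewrite -lee_fin; apply: le_trans h.
rewrite -sumEFin; apply: nneseries_lim_ge => k _ _.
by rewrite lee_fin.
Qed.

Section summable_distances.
Context {R : realType} {Y : pmetricType R}.

Lemma dist_le_path (u : nat -> Y) m p : (m <= p)%N ->
  mdist (u m) (u p) <= \sum_(m <= i < p) mdist (u i) (u i.+1).
Proof.
elim: p => [|p IHp]; first by rewrite leqn0 => /eqP ->;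
  rewrite big_geq// mdistxx.
rewrite leq_eqVlt => /orP[/eqP ->|]; first by rewrite big_geq// mdistxx.
rewrite ltnS => mp; rewrite big_nat_recr//=.
by rewrite (le_trans (metric_triangle _ (u p) _))// lerD2r IHp.
Qed.

Lemma summable_steps_cvg (u : nat -> Y) : compact [set: Y] ->
  (\sum_(k <oo) (mdist (u k) (u k.+1))%:E < +oo)%E ->
  exists l : Y, u n @[n --> \oo] --> l.
Proof.
move=> cY uoo; have [l [_ clu]] := cY (u @ \oo) _ filterT.
exists l; apply/(cvgrPdist_le (V := Y)) => e e0.
have [n nP] := nneseries_tail_le (fun k => mdist_ge0 _ _) uoo e0.
exists n => // m /= nm; apply/ler_addgt0Pl => d d0.
have [] := clu [set x | mdist (u m) x <= e] (ball l d).
- exists m => // p /= mp; exact: le_trans (dist_le_path _ mp) (nP _ _ nm).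
- exact: nbhsx_ballx.
move=> x [/= ux]; rewrite ballEmdist /= => lx.
have := metric_triangle l x (u m); rewrite (metric_sym x (u m)).
by move: ux lx; lra.
Qed.

Lemma summable_dist_cvg (u : nat -> Y) (y : Y) :
  (\sum_(k <oo) (mdist (u k) y)%:E < +oo)%E -> u n @[n --> \oo] --> y.
Proof.
move=> uoo; apply/(cvgrPdist_le (V := Y)) => e e0.
have [n nP] := nneseries_tail_le (fun k => mdist_ge0 _ _) uoo e0.
exists n => // m /= nm; have := nP m m.+1 nm.
by rewrite big_nat1 metric_sym.
Qed.

End summable_distances.

Lemma sum_blocks (V : nmodType) (f : nat -> V) k Q :
  \sum_(n < k * Q) f n = \sum_(i < k) \sum_(l < Q) f (i * Q + l)%N.
Proof.
elim: k => [|k IHk]; first by rewrite mul0n !big_ord0.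
by rewrite big_ord_recr /= -IHk mulSn addnC big_split_ord.
Qed.

(** A uniform bound on averages of length [N] passes to multiples of [N]; this
    provides a common length for two such bounds. *)
Lemma orbit_average_blocks (R : realType) (X : Type) (T : X -> X) (F : X -> R)
    (c : R) N k : (forall x, \sum_(n < N) F (iter n T x) <= c * N%:R) ->
  forall x, \sum_(n < k * N) F (iter n T x) <= c * (k * N)%:R.
Proof.
move=> FN x; rewrite (sum_blocks (fun n => F (iter n T x))).
have -> : c * (k * N)%:R = \sum_(i < k) c * N%:R.
  by rewrite sumr_const card_ord -[RHS]mulr_natl natrM; ring.
apply: ler_sum => i _.
under eq_bigr do rewrite addnC iterD.
exact: FN.
Qed.

Lemma measure_eq_on_conull d (T : measurableType d) (R : realType)
    (mu : {measure set T -> \bar R}) (W A B : set T) :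
  measurable W -> mu (~` W) = 0%E -> measurable A -> measurable B ->
  (forall x, W x -> A x <-> B x) -> mu A = mu B.
Proof.
move=> mW W0 mA mB AB.
have cut (C : set T) : measurable C -> mu C = mu (C `&` W).
  move=> mC; have D0 : mu (C `\` W) = 0%E.
    apply/eqP; rewrite -measure_le0 -W0; apply: le_measure; rewrite ?inE.
    - exact: measurableD.
    - exact: measurableC.
    - by move=> x [].
  rewrite -[RHS]add0e -D0; exact: measureDI.
rewrite (cut _ mA) (cut _ mB); congr (mu _); apply/seteqP.
by split=> x [h Wx]; split => //; apply/AB.
Qed.

Lemma conullI d (T : measurableType d) (R : realType)
    (mu : {measure set T -> \bar R}) (A B : set T) :
  measurable A -> measurable B -> mu (~` A) = 0%E -> mu (~` B) = 0%E ->
  mu (~` (A `&` B)) = 0%E.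
Proof.
move=> mA mB A0 B0; rewrite setCI.
apply: measure_negligible; first by apply: measurableU; exact: measurableC.
by apply: negligibleU; apply/negligibleP => //; exact: measurableC.
Qed.

(** The projection restricted to the graph of [phi] is the inverse of the
    graph map. The graph itself need not be known to be Borel: it contains the
    conull Borel set [W], and completed sigma-algebras ignore the rest. *)
Lemma graph_measure_isomorphism (R : realType) (Z Y : pmetricType R)
    (nu : probability (borel Z) R) (phi : Z -> Y) :
  let gam (z : borel Z) : borel (Z * Y)%type := (z, phi z) in
  measurable_fun setT gam ->
  forall (mu : probability (borel (Z * Y)%type) R)
    (W : set (borel (Z * Y)%type)),
  (forall A, mu A = nu (gam @^-1` A)) -> measurable W -> mu (~` W) = 0%E ->
  (forall x, W x -> x = gam x.1) -> measure_isomorphism mu nu fst.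
Proof.
move=> gam mgam mu W muE mW W0 Wgraph.
have mpre (A : set (borel (Z * Y)%type)) :
    measurable A -> measurable (gam @^-1` A).
  move=> mA; rewrite -[X in measurable X]setTI.
  exact: (mgam measurableT _ mA).
have mfst (B : set (borel Z)) : measurable B ->
    measurable (fst @^-1` B : set (borel (Z * Y)%type)).
  move=> mB.
  have mf : measurable_fun setT (fst : borel (Z * Y)%type -> borel Z).
    by apply: continuous_borel; exact: continuous_fst.
  by rewrite -[X in measurable X]setTI; exact: mf.
split; first by move=> B mB; rewrite muE.
exists (range gam), setT; split.
- exists (~` W); split; [exact: measurableC | exact: W0 |].
  by apply: subsetC => x /Wgraph ->; exists x.1.
- by rewrite setCT; exact: negligible_set0.
- split => //.
    by move=> _ _ /set_mem[z _ <-] /set_mem[z' _ <-] /= ->.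
  by move=> z _; exists (gam z) => //; exists z.
- move=> A Agraph.
  have imA : fst @` A = gam @^-1` A.
    apply/seteqP; split=> z /=.
      by move=> [x Ax <-]; have [z' _ xE] := Agraph x Ax; move: Ax; rewrite -xE.
    by move=> Az; exists (gam z).
  split.
    rewrite imA => -[B mB [N [N' [mN' N'0 NN']] BN]].
    exists (gam @^-1` B); first exact: mpre.
    exists (gam @^-1` N); last by rewrite -BN.
    exists (gam @^-1` N'); split => //; first exact: mpre.
      exact: etrans (esym (muE _)) N'0.
    by move=> z /NN'.
  move=> [B mB [N [N' [mN' N'0 NN']] BN]].
  exists (W `&` fst @^-1` B); first by apply: measurableI => //; exact: mfst.
  exists (A `\` (W `&` fst @^-1` B)).
    exists (~` W `|` fst @^-1` N'); split.
    + by apply: measurableU; [exact: measurableC | exact: mfst].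
    + rewrite -[_ `|` _]setCK setCU setCK.
      apply: conullI => //; first by apply: measurableC; exact: mfst.
      by rewrite setCK; exact: etrans (muE _) N'0.
    move=> x [Ax nWB]; have [Wx|] := pselect (W x); last by left.
    right; apply: NN'; have : (B `|` N) x.1 by rewrite BN; exists x.
    by case=> // Bx; exfalso; apply: nWB.
  rewrite setDUK// => x [Wx Bx].
  have : (fst @` A) x.1 by rewrite -BN; left.
  by rewrite imA /= -(Wgraph x Wx).
Qed.

Section invariant_graph.
Context {R : realType} {Z Y : pmetricType R}.
Variables (S : homeo Z) (T : homeo (Z * Y)%type).
Hypotheses (cZ : compact [set: Z]) (cY : compact [set: Y]).
Hypothesis T_fst : forall x, (T x).1 = S x.1.
Variable nu : probability (borel Z) R.
Hypothesis nu_uniq : unique_invariant_measure S nu.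

(** Unique ergodicity of the base determines the marginal. *)
Lemma invariant_measure_fst (mu : probability (borel (Z * Y)%type) R) :
  invariant_measure T mu ->
  forall B : set (borel Z), measurable B -> mu (fst @^-1` B) = nu B.
Proof.
move=> Tmu B mB.
have mfst : measurable_fun setT (fst : borel (Z * Y)%type -> borel Z).
  by apply: continuous_borel => ?; exact: cvg_fst.
pose f : {mfun (borel (Z * Y)%type) >-> (borel Z)} := mfun_Sub (mem_set mfst).
have := nu_uniq.2 (distribution mu f).
apply => // A mA; rewrite /distribution /pushforward /=.
transitivity (mu (T @^-1` (fst @^-1` A))).
  by congr (mu _); apply/seteqP; split=> x /=; rewrite T_fst.
by apply: Tmu; rewrite -[X in measurable X]setTI; have := mfst; apply.
Qed.

Hypothesis sections : forall e : R, 0 < e -> exists s : Z -> Y,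
  [/\ continuous s,
      (forall z, mdist (T (z, s z)).2 (s (S z)) <= e) &
      exists2 N, (0 < N)%N & forall x,
        \sum_(n < N) mdist (s (iter n T x).1) (iter n T x).2 <= e * N%:R].

(** The hypothesis provides continuous sections [s k] whose distance to the
    second coordinate has orbit averages, hence integral against any invariant
    measure of [T], at most [2 ^- k.+1]. The Borel set [X1] where these
    distances are summable is therefore conull for every invariant measure;
    [Z1] is the analogous set for the distances of consecutive sections. The
    sections converge to [phi] on [Z1], and [X1] is contained in the graph of
    [phi] above it. *)
Lemma isomorphic_extension_of_sections : isomorphic_extension R T S fst.
Proof.
have ek k : 0 < (1 / (2 ^ k.+1)%:R : R) by rewrite divr_gt0// ltr0n expn_gt0.
have /choice[s Hs] : forall k, exists s : Z -> Y,
  [/\ continuous s,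
      (forall z, mdist (T (z, s z)).2 (s (S z)) <= (1 / (2 ^ k.+1)%:R : R)) &
      exists2 N, (0 < N)%N & forall x,
        \sum_(n < N) mdist (s (iter n T x).1) (iter n T x).2 <= (1 / (2 ^
          k.+1)%:R) * N%:R].
  by move=> k; exact: sections (ek k).
have cs k : continuous (s k) by have [] := Hs k.
have cfst : continuous (@fst Z Y) by move=> ?; exact: cvg_fst.
have csnd : continuous (@snd Z Y) by move=> ?; exact: cvg_snd.
have iter_fst n x : (iter n T x).1 = iter n S x.1.
  by elim: n => [//|n IHn]; rewrite /= T_fst IHn.
pose F k (x : Z * Y) : R := mdist (s k x.1) x.2.
have cF k : continuous (F k).
  exact: (mdist_comp_continuous (continuousT_comp cfst (cs k)) csnd).
have mF k : measurable_fun setT (F k : borel (Z * Y)%type -> R).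
  exact: continuous_real_borel.
pose D k (z : Z) : R := mdist (s k z) (s k.+1 z).
have cD k : continuous (D k) by exact: mdist_comp_continuous.
have mD k : measurable_fun setT (D k : borel Z -> R).
  exact: continuous_real_borel.
set X1 : set (borel (Z * Y)%type) := [set x | (\sum_(k <oo) (F k x)%:E <
  +oo)%E].
set Z1 : set (borel Z) := [set z | (\sum_(k <oo) (D k z)%:E < +oo)%E].
have [mZ1 nuZ1] : measurable Z1 /\ nu (~` Z1) = 0%E.
  apply: (@summable_ae _ _ _ nu D 2) => // [k z|k]; first exact: mdist_ge0.
  have [_ _ [N N0 NP]] := Hs k; have [_ _ [N' N'0 N'P]] := Hs k.+1.
  apply: (@integral_le_orbit_average _ _ S _ _ _ (N * N')%N nu_uniq.1) => //.
  - by move=> z; exact: mdist_ge0.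
  - by rewrite muln_gt0 N0.
  move=> z; pose x : Z * Y := (z, point).
  apply: (@le_trans _ _ (\sum_(n < N * N') (F k (iter n T x) + F k.+1 (iter n
    T x)))).
    apply: ler_sum => n _; rewrite /D /F !iter_fst /=.
    by rewrite (metric_sym (s k.+1 _)); exact: metric_triangle.
  rewrite big_split /=.
  have h1 := @orbit_average_blocks R _ T (F k) _ N N' NP x.
  have h2 := @orbit_average_blocks R _ T (F k.+1) _ N' N N'P x.
  rewrite mulnC in h1.
  apply: (le_trans (lerD h1 h2)); rewrite -mulrDl ler_wpM2r//.
  have -> : 2 / (2 ^ k.+1)%:R = 1 / (2 ^ k.+1)%:R + 1 / (2 ^ k.+1)%:R :> R by
    ring.
  rewrite lerD2l !div1r lef_pV2 ?posrE ?ltr0n ?expn_gt0// ler_nat.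
  by rewrite leq_exp2l.
have X1P (mu : probability (borel (Z * Y)%type) R) : invariant_measure T mu ->
    measurable X1 /\ mu (~` X1) = 0%E.
  move=> Tmu; apply: (@summable_ae _ _ _ mu F 1) => // [k x|k];
    first exact: mdist_ge0.
  have [_ _ [N N0 NP]] := Hs k.
  apply: (@integral_le_orbit_average _ _ T _ _ _ N Tmu) => //.
  by move=> x; exact: mdist_ge0.
have /choice[phi Hphi] : forall z : Z, exists l : Y,
    (Z1 z -> s k z @[k --> \oo] --> l) /\ (~ Z1 z -> l = point).
  move=> z; have [Zz|Zz] := pselect (Z1 z).
    by have [l sl] := summable_steps_cvg cY Zz; exists l.
  by exists point.
pose gam (z : borel Z) : borel (Z * Y)%type := (z, phi z).
have mgam : measurable_fun setT gam.
  (* off Z1 the sections are replaced by a constant, to converge everywhere *)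
  pose t k z := if z \in Z1 then s k z else point.
  apply: (@measurable_pointwise_limit _ _ _ (fun k z => (z, t k z))).
  - exact: prod_second_countable.
  - exact: uniform_regular.
  - move=> k; apply: borel_measurable_fun => U oU.
    have c1 : continuous (fun z : Z => (z, s k z)).
      by apply: continuous_pairing => //; move=> ?; exact: cvg_id.
    have c2 : continuous (fun z : Z => (z, point : Y)).
      by apply: continuous_pairing; move=> ?; [exact: cvg_id | exact: cvg_cst].
    rewrite (_ : _ @^-1` U = (Z1 `&` (fun z => (z, s k z)) @^-1` U) `|`
        (~` Z1 `&` (fun z => (z, point : Y)) @^-1` U)).
      apply: measurableU; apply: measurableI => //; last 1 first.
      + by apply: open_borel; move/continuousP : c2; exact.
      + by apply: open_borel; move/continuousP : c1; exact.
      + exact: measurableC.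
    apply/seteqP; split => z /=.
      by rewrite /t; case: ifPn; [rewrite inE; left | rewrite notin_setE;
        right].
    rewrite /t; case=> -[h1 h2]; first by rewrite mem_set.
    by rewrite memNset.
  - move=> z; apply: cvg_pair => /=; first exact: cvg_cst.
    have [Zz|Zz] := pselect (Z1 z).
      rewrite (_ : (fun k => t k z) = (fun k => s k z));
        first exact: (Hphi z).1.
      by apply/funext => k; rewrite /t mem_set.
    rewrite (_ : (fun k => t k z) = (fun=> point)); last first.
      by apply/funext => k; rewrite /t memNset.
    by rewrite ((Hphi z).2 Zz); exact: cvg_cst.
pose g : {mfun (borel Z) >-> (borel (Z * Y)%type)} := mfun_Sub (mem_set mgam).
pose mu : probability (borel (Z * Y)%type) R := distribution nu g.
have muE A : mu A = nu (gam @^-1` A) by [].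
have mpre (A : set (borel (Z * Y)%type)) : measurable A -> measurable (gam
  @^-1` A).
  by move=> mA; rewrite -[X in measurable X]setTI;
    exact: (mgam measurableT _ mA).
have mfst (B : set (borel Z)) : measurable B ->
    measurable (fst @^-1` B : set (borel (Z * Y)%type)).
  move=> mB; have mf : measurable_fun setT (fst : borel (Z * Y)%type -> borel
    Z).
    exact: continuous_borel.
  by rewrite -[X in measurable X]setTI; exact: mf.
have Smeas (B : set (borel Z)) : measurable B -> measurable (S @^-1` B : set
  (borel Z)).
  move=> mB; have mS : measurable_fun setT (S : borel Z -> borel Z).
    by apply: continuous_borel; exact: homeo_fun_continuous.
  by rewrite -[X in measurable X]setTI; exact: mS.
have Tmeas (B : set (borel (Z * Y)%type)) : measurable B ->
    measurable (T @^-1` B : set (borel (Z * Y)%type)).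
  move=> mB; have mT : measurable_fun setT (T : borel (Z * Y)%type -> borel (Z
    * Y)%type).
    by apply: continuous_borel; exact: homeo_fun_continuous.
  by rewrite -[X in measurable X]setTI; exact: mT.
(* the k-th section is invariant up to 2 ^- k.+1, so the limit is invariant *)
have invar z : Z1 z -> Z1 (S z) -> T (gam z) = gam (S z).
  move=> Zz ZSz; rewrite [T _]surjective_pairing /gam T_fst /=; congr (_, _).
  have cTz : (T (z, s k z)).2 @[k --> \oo] --> (T (z, phi z)).2.
    have cz : continuous (fun y : Y => (T (z, y)).2).
      have c1 : continuous (fun _ : Y => z) by move=> ?; exact: cvg_cst.
      have c2 : continuous (fun y : Y => y) by move=> ?; exact: cvg_id.
      exact: (continuousT_comp (continuousT_comp (continuous_pairing c1 c2)
        (@homeo_fun_continuous _ T)) csnd).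
    exact: (@cvg_comp _ _ _ (fun k => s k z) (fun y => (T (z,
      y)).2) _ _ _ ((Hphi z).1 Zz) (cz (phi z))).
  have cSz := (Hphi (S z)).1 ZSz.
  apply/eqP; rewrite -[_ == _]negbK -mdist_gt0; apply/negP => d0.
  set d := mdist _ _ in d0.
  have d40 : 0 < d / 4 by rewrite divr_gt0.
  have /(cvgrPdist_lt (V := Y))/(_ _ d40) n1 := cTz.
  have /(cvgrPdist_lt (V := Y))/(_ _ d40) n2 := cSz.
  have [n _ nP] := filterI n1 n2.
  pose k := maxn n (Num.truncn (4 / d)).
  have [/= h1 h2] := nP k (leq_maxl _ _).
  have [_ /(_ z) h3 _] := Hs k.
  have h4 : 1 / (2 ^ k.+1)%:R < d / 4.
    rewrite div1r -[ltRHS]invrK ltf_pV2 ?posrE ?invr_gt0 ?ltr0n ?expn_gt0//.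
    rewrite invf_div (lt_le_trans (truncnS_gt _))// ler_nat.
    apply: leq_trans (ltnW (ltn_expl k.+1 (ltnSn 1))).
    by rewrite ltnS leq_maxr.
  have := metric_triangle (T (z, phi z)).2 (T (z, s k z)).2 (phi (S z)).
  have := metric_triangle (T (z, s k z)).2 (s k (S z)) (phi (S z)).
  rewrite (metric_sym (s k (S z))) -/d.
  by move: h1 h2 h3 h4; lra.
have muT : invariant_measure T mu.
  move=> A mA; rewrite !muE.
  rewrite -[RHS](nu_uniq.1); last exact: mpre.
  apply: (@measure_eq_on_conull _ _ _ nu (Z1 `&` S @^-1` Z1)).
  - by apply: measurableI => //; exact: Smeas.
  - apply: conullI => //; first exact: Smeas.
    by apply: etrans nuZ1; apply: (nu_uniq.1 (~` Z1)); exact: measurableC.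
  - by apply: mpre; exact: Tmeas.
  - by apply: Smeas; exact: mpre.
  - by move=> z [Zz ZSz]; rewrite /preimage /= invar.
pose W : set (borel (Z * Y)%type) := X1 `&` fst @^-1` Z1.
have mX1 : measurable X1 by have [] := X1P mu muT.
have mW : measurable W by apply: measurableI => //; exact: mfst.
have W0 (mu' : probability (borel (Z * Y)%type) R) : invariant_measure T mu' ->
    mu' (~` W) = 0%E.
  move=> Tmu'; apply: conullI => //; [exact: mfst|exact: (X1P mu' Tmu').2|].
  apply: etrans nuZ1; apply: (invariant_measure_fst Tmu' (B := ~` Z1)).
  exact: measurableC.
have Wgraph x : W x -> x = gam x.1.
  move: x => [z y] [X1x /= Zz]; rewrite /gam; congr (_, _).
  have h1 : s k z @[k --> \oo] --> y by exact: summable_dist_cvg.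
  exact: (@cvg_unique _ (@metric_hausdorff R Y) _ _ _ _ h1 ((Hphi z).1 Zz)).
(* on W a set and the preimage of its trace on the graph coincide *)
have uniq : unique_invariant_measure T mu.
  split => // mu' Tmu' A mA; rewrite muE.
  rewrite -(invariant_measure_fst Tmu'); last exact: mpre.
  apply: (@measure_eq_on_conull _ _ _ mu' W) => //.
  - exact: W0.
  - by apply: mfst; exact: mpre.
  - by move=> x Wx; rewrite {1}(Wgraph x Wx).
split; first by split => // z _; exists (z, point).
exists mu, nu; split => //.
exact: (@graph_measure_isomorphism _ _ _ nu phi mgam mu W muE mW (W0 mu muT)).
Qed.

End invariant_graph.

(** * Counting along a periodic path *)

Lemma sum_mod_shift (V : nmodType) (F : nat -> V) n T :
  \sum_(i < n) F ((T + i) %% n)%N = \sum_(i < n) F i.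
Proof.
elim: T => [|T IHT].
  by apply: eq_bigr => i _; rewrite add0n modn_small.
rewrite -{}IHT; case: n => [|n]; first by rewrite !big_ord0.
rewrite big_ord_recr [RHS]big_ord_recl /= addrC addn0; congr (_ + _).
  by rewrite addSnnS modnDr.
by apply: eq_bigr => i _; rewrite /bump /= addSnnS.
Qed.

Section profile.
Context {R : realType} {E : Type}.
Variables (g : nat -> E) (Gam : nat -> R -> E) (k : nat).
Hypothesis k2 : (2 <= k)%N.
Hypothesis Gam0 : forall j (t : R), t <= 0 -> Gam j t = g j.
Hypothesis Gam1 : forall j (t : R), 1 <= t -> Gam j t = g j.+1.

(** A path through [g 0, g 1, ..]: on the unit interval starting at [j] it
    rests at [g j] except for a final fraction [1 / k], in which it follows
    [Gam j] from [g j] to [g j.+1]. *)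
Definition profile (s : R) : E :=
  Gam (Num.truncn s) (k%:R * (s - (Num.truncn s)%:R) - k%:R + 1).

(** On an interval of length [1 / 2] a single formula describes the profile,
    even across an integer: the rest period that follows the integer is long
    enough for [Gam j], continued beyond time one, to agree. Continuity and
    moduli of continuity are thereby inherited from the paths [Gam j]. *)
Lemma profile_window (s s' : R) : 0 <= s -> s <= s' -> s' <= s + 1 / 2 ->
  profile s' = Gam (Num.truncn s) (k%:R * (s' - (Num.truncn s)%:R) - k%:R + 1).
Proof.
have k2R : 2 <= k%:R :> R by rewrite ler_nat.
move=> s0 ss' s's; have /truncn_itv := s0.
move: (Num.truncn s) => j /andP[js sj].
have [s'j|js'] := ltP s' j.+1%:R.
  rewrite /profile (_ : Num.truncn s' = j)//.
  by apply/truncn_def; rewrite s'j (le_trans js).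
have tj : Num.truncn s' = j.+1.
  apply/truncn_def; rewrite js' /=.
  move: sj s's; rewrite -(natr1 j.+1) -(natr1 j). lra.
rewrite /profile tj Gam0; last first.
  move: sj s's; rewrite -natr1 => sj s's.
  have : k%:R * (s' - (j%:R + 1)) <= k%:R * (1 / 2).
    have h : s' - (j%:R + 1) <= 1 / 2 by lra.
    have h0 : 0 < k%:R :> R by lra.
    by rewrite ler_pM2l.
  by lra.
rewrite Gam1//; move: js'; rewrite -natr1 => js'.
have : k%:R * 1 <= k%:R * (s' - j%:R) by rewrite ler_pM2l; lra.
by lra.
Qed.

Lemma profile_flat (s : R) j : j%:R <= s -> s <= j%:R + 1 - k%:R^-1 ->
  profile s = g j.
Proof.
have k2R : 2 <= k%:R :> R by rewrite ler_nat.
move=> js sj; have k0 : 0 < k%:R :> R by lra.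
have ki : 0 < k%:R^-1 :> R by rewrite invr_gt0.
rewrite /profile (_ : Num.truncn s = j); last first.
  by apply/truncn_def; rewrite js /= -natr1; lra.
rewrite Gam0//.
have : k%:R * (s - j%:R) <= k%:R * (1 - k%:R^-1) by rewrite ler_pM2l; lra.
by rewrite [X in _ <= X -> _]mulrBr divff ?gt_eqF//; lra.
Qed.

(** Sampling one period [M] with step [1 / (k * q)]: indices congruent modulo
    [k * q] meet the [M] intervals at the same fractional position, so that
    either each of [g 0, .., g M.-1] is sampled once, or all these samples
    may fall into transitions; the latter happens for at most [q] of the
    [k * q] residues. *)
Lemma profile_count (beta : E -> R) (M q : nat) (eps : R) (t : R) :
  (0 < M)%N -> (0 < q)%N ->
  (forall j, g j = g (j %% M)%N) -> (forall x, 0 <= beta x <= 1) ->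
  \sum_(j < M) beta (g j) <= eps * M%:R -> 0 <= t ->
  \sum_(i < M * (k * q)) beta (profile ((t + i%:R) / (k * q)%:R)) <=
    (eps + k%:R^-1) * (M * (k * q))%:R.
Proof.
have k2R : 2 <= k%:R :> R by rewrite ler_nat.
move=> M0 q0 gM b01 bM t0; set lam := (k * q)%N.
have lam0 : (0 < lam)%N by rewrite muln_gt0 q0 andbT; lia.
have lamR : 0 < lam%:R :> R by rewrite ltr0n.
have k0 : 0 < k%:R :> R by lra.
rewrite (sum_blocks (fun i =>
  beta (profile ((t + i%:R) / lam%:R)))) exchange_big /=.
have /truncn_itv := t0; move: (Num.truncn t) => T /andP[Tt tT].
pose bad n : R := (lam - q <= n)%N%:R.
have eps0 : 0 <= eps.
  have : 0 <= eps * M%:R.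
    by apply: le_trans bM; apply: sumr_ge0 => j _; have /andP[] := b01 (g j).
  by rewrite pmulr_lge0// ltr0n.
have step (l : 'I_lam) : \sum_(i < M)
    beta (profile ((t + (i * lam + l)%N%:R) / lam%:R)) <=
    eps * M%:R + M%:R * bad ((T + l) %% lam)%N.
  rewrite /bad; case: leqP => [_|good].
    rewrite mulr1 -[leLHS]add0r lerD//; first by rewrite mulr_ge0.
    apply: (@le_trans _ _ (\sum_(i < M) 1)).
      by apply: ler_sum => i _; have /andP[] := b01 (profile ((t + (i * lam +
        l)%N%:R) / lam%:R)).
    by rewrite sumr_const card_ord.
  rewrite mulr0 addr0; apply: le_trans bM.
  rewrite -(sum_mod_shift (fun j => beta (g j)) M ((T + l) %/ lam)).
  apply: ler_sum => i _; rewrite -gM (profile_flat (j := ((T + l) %/ lam +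
    i)%N))//.
    rewrite ler_pdivlMr// -natrM mulnDl.
    have : (((T + l) %/ lam) * lam + i * lam <= T + (i * lam + l))%N.
      by have := leq_trunc_div (T + l) lam; lia.
    by rewrite -(ler_nat R) [X in _ <= X -> _]natrD; lra.
  rewrite ler_pdivrMr//.
  have -> : (((T + l) %/ lam + i)%N%:R + 1 - k%:R^-1) * lam%:R =
      (((T + l) %/ lam + i) * lam + lam)%N%:R - q%:R :> R.
    rewrite [in RHS]natrD [in RHS]natrM; move: (_ + i)%N => u.
    rewrite /lam natrM.
    by field; rewrite gt_eqF.
  have : (T + (i * lam + l) + 1 + q <= ((T + l) %/ lam + i) * lam + lam)%N.
    have := divn_eq (T + l) lam.
    have : (q <= lam)%N by rewrite /lam leq_pmull//; lia.
    by move: good; rewrite mulnDl; lia.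
  rewrite -(ler_nat R) !natrD; move: tT; rewrite -natr1; lra.
apply: (@le_trans _ _ (\sum_(l < lam) (eps * M%:R + M%:R * bad ((T + l) %%
  lam)%N))).
  by apply: ler_sum => l _; exact: step.
rewrite big_split /= sumr_const card_ord -mulr_sumr (sum_mod_shift bad).
have -> : \sum_(i < lam) bad i = q%:R.
  rewrite -natr_sum; congr _%:R.
  rewrite -(big_mkord xpredT (fun i => (lam - q <= i)%N : nat)).
  have qlam : (q <= lam)%N by rewrite /lam leq_pmull//; lia.
  rewrite (big_cat_nat (n := (lam - q)%N)) ?leq_subr//= big_nat_cond big1 =>
    [|i]; last first.
    by rewrite andbT => /andP[_]; rewrite ltnNge => /negbTE ->.
  rewrite add0n big_nat_cond (eq_bigr (fun=> 1%N)) => [|i]; last first.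
    by rewrite andbT => /andP[->].
  by rewrite -big_nat_cond sum_nat_const_nat muln1 subKn.
rewrite -[_ *+ lam]mulr_natr /lam !natrM.
rewrite le_eqVlt; apply/orP; left; apply/eqP.
by field; rewrite gt_eqF.
Qed.

End profile.

(** Along [K] blocks of [Q] steps, [a] counts up and [b] counts down, except at
    a single visit [v]. In a block without a visit [min a b] moves in one
    direction at unit speed, unless the sign of [b - a] changes in it. The
    number of sign changes from [a <= b] to [b < a] is bounded by telescoping,
    since changes in the opposite direction need a visit; hence at most three
    blocks are lost. *)
Lemma window_count (R : realType) (beta : R -> R) (a b : nat -> R)
    (v : nat -> bool) (Q K : nat) (eps : R) :
  (0 < Q)%N -> 0 <= eps -> (forall x, 0 <= beta x <= 1) ->
  (forall t, 0 <= t -> \sum_(i < Q) beta (t + i%:R) <= eps * Q%:R) ->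
  (forall n, 0 <= a n) -> (forall n, 0 <= b n) ->
  (forall n, ~~ v n -> a n.+1 = a n + 1) ->
  (forall n, ~~ v n -> b n = b n.+1 + 1) ->
  (\sum_(n < K * Q) v n <= 1)%N ->
  \sum_(n < K * Q) beta (Num.min (a n) (b n)) <= eps * (K * Q)%:R + 3 * Q%:R.
Proof.
move=> Q0 eps0 b01 bQ a0 b0 av bv v1.
have QR : 0 <= Q%:R :> R by [].
pose f n := beta (Num.min (a n) (b n)).
pose s m : R := (b m < a m)%R%:R.
have f1 m n : \sum_(l < n) f (m + l)%N <= n%:R.
  apply: (@le_trans _ _ (\sum_(l < n) 1)).
    by apply: ler_sum => i _; have /andP[] := b01 (Num.min (a (m + i)%N) (b (m
      + i)%N)).
  by rewrite sumr_const card_ord.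
have block m : \sum_(l < Q) f (m + l)%N <=
    eps * Q%:R + Q%:R * (2 * (\sum_(l < Q) v (m + l)%N)%N%:R + (s (m + Q)%N -
      s m)).
  have s01 n : 0 <= s n <= 1 by rewrite /s; case: (_ < _); rewrite lexx ler01.
  have epsQ : 0 <= eps * Q%:R by rewrite mulr_ge0.
  have [v0|vpos] := posnP (\sum_(l < Q) v (m + l)%N); last first.
    apply: le_trans (f1 m Q) _; rewrite -[leLHS]add0r lerD// ler_peMr//.
    have : 1 <= (\sum_(l < Q) v (m + l)%N)%N%:R :> R by rewrite ler1n.
    have := s01 m; have := s01 (m + Q)%N; lra.
  rewrite v0 mulr0 add0r.
  have nv l : (l < Q)%N -> ~~ v (m + l)%N.
    move=> lQ; move/eqP: v0; rewrite sum_nat_eq0 =>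
      /forallP/(_ (Ordinal lQ)) /=.
    by case: (v _).
  have aE l : (l <= Q)%N -> a (m + l)%N = a m + l%:R.
    elim: l => [|l IHl] lQ; first by rewrite addn0 addr0.
    by rewrite addnS av ?nv// IHl ?(ltnW lQ)// -natr1 addrA.
  have bE l : (l <= Q)%N -> b (m + l)%N = b m - l%:R.
    elim: l => [|l IHl] lQ; first by rewrite addn0 subr0.
    have := bv _ (nv _ lQ); rewrite IHl ?(ltnW lQ)// -addnS -natr1; lra.
  have [bam|abm] := ltP (b m) (a m).
    rewrite /s bam bE// aE//.
    have -> : (b m - Q%:R < a m + Q%:R) by lra.
    rewrite subrr mulr0 addr0.
    have t0 : 0 <= b m - Q.-1%:R by rewrite -bE ?leq_pred.
    apply: le_trans (bQ _ t0); rewrite le_eqVlt; apply/orP; left; apply/eqP.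
    rewrite (reindex_inj rev_ord_inj) /=; apply: eq_bigr => i _.
    have iQ := ltn_ord i.
    rewrite /f aE ?leq_subr// bE ?leq_subr//.
    have -> : (Q - i.+1)%N%:R = Q.-1%:R - i%:R :> R.
      by rewrite -natrB; [congr (_%:R); lia | lia].
    have : i%:R <= Q.-1%:R :> R by rewrite ler_nat; lia.
    move=> iQR; rewrite min_r; first by congr beta; ring.
    by lra.
  have sm : s m = 0 by rewrite /s ltNge abm.
  have [bamQ|abmQ] := ltP (b (m + Q)%N) (a (m + Q)%N).
    by rewrite sm /s bamQ subr0 mulr1 -[leLHS]add0r lerD.
  rewrite sm /s ltNge abmQ subr0 mulr0 addr0.
  apply: le_trans (bQ _ (a0 m)); apply: ler_sum => i _.
  have iQ := ltn_ord i.
  rewrite /f aE 1?ltnW// bE 1?ltnW// min_l//.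
  move: abmQ; rewrite aE// bE//.
  have : i%:R <= Q%:R :> R by rewrite ler_nat ltnW.
  by lra.
rewrite (sum_blocks f); apply: (@le_trans _ _ (\sum_(i < K) (eps * Q%:R + Q%:R *
    (2 * (\sum_(l < Q) v (i * Q + l)%N)%N%:R + (s (i * Q + Q)%N - s (i *
      Q)%N))))).
  by apply: ler_sum => i _; exact: block.
rewrite big_split /= sumr_const card_ord -mulr_sumr big_split /= -mulr_sumr.
rewrite -natr_sum -(sum_blocks (fun n => v n : nat)).
have -> : \sum_(i < K) (s (i * Q + Q)%N - s (i * Q)%N) = s (K * Q)%N - s 0%N.
  elim: (K) => [|n IHn]; first by rewrite big_ord0 mul0n subrr.
  by rewrite big_ord_recr /= IHn mulSn [(Q + _)%N]addnC; ring.
rewrite -[_ *+ K]mulr_natr natrM (mulrC K%:R) mulrA lerD2l (mulrC Q%:R)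
  ler_wpM2r//.
have h1 : (\sum_(n < K * Q) v n)%N%:R <= 1 :> R by rewrite (ler_nat R _ 1).
have h2 : s (K * Q)%N <= 1 by rewrite /s; case: (_ < _).
have h3 : 0 <= s 0%N by rewrite /s; case: (_ < _).
by lra.
Qed.

(** * Slow functions on a minimal system *)

Lemma continuousT_min (R : realType) (X : topologicalType) (f g : X -> R) :
  continuous f -> continuous g -> continuous (fun x => Num.min (f x) (g x)).
Proof.
by move=> cf cg x; apply: (@continuous_min R X f g x); [exact: cf | exact: cg].
Qed.

(** [B z] is the minimum of [n + u (T^n z)] over [n]; only [n <= m] matter since
    [u] is at most [m]. Solving the equation by iteration keeps continuity
    evident. *)
Lemma slow_fixpoint (R : realType) (Z : topologicalType) (T : Z -> Z)
    (u : Z -> R) (m : nat) :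
  continuous T -> continuous u -> (forall z, 0 <= u z <= m%:R) ->
  exists B : Z -> R, [/\ continuous B, forall z, 0 <= B z &
    forall z, B z = Num.min (u z) (1 + B (T z))].
Proof.
move=> cT cu u0m.
pose B := fix B k : Z -> R := if k is k'.+1
  then (fun z => Num.min (u z) (1 + B k' (T z))) else u.
have cB k : continuous (B k).
  elim: k => [|k IHk] //=; apply: continuousT_min => //.
  have cBT := continuousT_comp cT IHk.
  by move=> z; apply: cvgD; [exact: cvg_cst | exact: cBT].
have B0 k z : 0 <= B k z.
  elim: k z => [|k IHk] z /=; first by have /andP[] := u0m z.
  rewrite le_min; have /andP[-> _] := u0m z.
  by rewrite addr_ge0.
have Bdec k z : B k.+1 z <= B k z.
  elim: k z => [|k IHk] z; first by rewrite /= ge_min lexx.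
  rewrite [leRHS]/= le_min; apply/andP; split; first by rewrite /= ge_min lexx.
  by rewrite [leLHS]/= ge_min lerD2l IHk orbT.
have Bcap k z : Num.min (B k z) k.+1%:R <= B k.+1 z.
  elim: k z => [|k IHk] z.
    rewrite /= le_min !ge_min lexx /=; apply/orP; right.
    by rewrite lerDl (B0 0%N).
  rewrite [leRHS]/= le_min; apply/andP; split; first by rewrite /= !ge_min lexx.
  apply: (@le_trans _ _ (1 + Num.min (B k (T z)) k.+1%:R));
    last by rewrite lerD2l.
  have -> : 1 + Num.min (B k (T z)) k.+1%:R = Num.min (1 + B k (T z)) k.+2%:R.
    by rewrite addr_minr -[k.+2%:R]natr1 (addrC _ 1).
  by rewrite /= le_min !ge_min !lexx !orbT.
exists (B m); split => // z.
apply/eqP; rewrite eq_le; apply/andP; split; last exact: Bdec.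
apply: le_trans (Bcap m z); rewrite le_min lexx /=.
have Bu : B m z <= u z by case: (m) => [//|k] /=; rewrite ge_min lexx.
have /andP[_ um] := u0m z.
by rewrite (le_trans Bu)// (le_trans um)// ler_nat.
Qed.

Section minimal_homeo.
Context {R : realType} {Z : pmetricType R}.
Variable S : homeo Z.
Hypotheses (cZ : compact [set: Z]) (minS : minimal S).

Lemma iter_homeo_invK n m z : (n <= m)%N ->
  iter n (homeo_inv S) (iter m S z) = iter (m - n) S z.
Proof.
elim: n m => [|n IHn] m; first by rewrite subn0.
case: m => // m; rewrite ltnS subSS => nm.
by rewrite iterSr /= homeo_funK IHn.
Qed.

Lemma iter_homeoK n m z : (n <= m)%N ->
  iter n S (iter m (homeo_inv S) z) = iter (m - n) (homeo_inv S) z.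
Proof.
elim: n m => [|n IHn] m; first by rewrite subn0.
case: m => // m; rewrite ltnS subSS => nm.
by rewrite iterSr /= homeo_invK IHn.
Qed.

Lemma expgn_homeo_invE n z : (S ^- n)%g z = iter n (homeo_inv S) z.
Proof.
rewrite -[(S ^- n)%g]expVgn expgn_homeoE; exact: eq_iter.
Qed.

(** Compactness turns density of the orbits into a uniform waiting time. *)
Lemma two_sided_syndetic (W : set Z) : open W -> W !=set0 ->
  exists N, forall z, exists2 n, (n <= N)%N &
    W (iter n S z) \/ W (iter n (homeo_inv S) z).
Proof.
move=> oW W0.
have : \forall N \near \oo, forall z : Z, exists2 n, (n <= N)%N &
    W (iter n S z) \/ W (iter n (homeo_inv S) z).
  apply: near_compactT => // z.
  have [w [Ww]] := minS z W0 oW.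
  case=> -[n _ nw].
    have : nbhs z (iter n S @^-1` W).
      have citer : continuous (iter n S).
        by apply: iter_continuous; exact: homeo_fun_continuous.
      apply: citer; apply: open_nbhs_nbhs; split => //.
      by rewrite -expgn_homeoE nw.
    move=> nz; exists (iter n S @^-1` W, [set N | (n <= N)%N]).
      by split => //=; exists n.
    by move=> [z' N] /= [Wz' nN]; exists n => //; left.
  have : nbhs z (iter n (homeo_inv S) @^-1` W).
    have citer : continuous (iter n (homeo_inv S)).
      by apply: iter_continuous; exact: homeo_inv_continuous.
    apply: citer; apply: open_nbhs_nbhs; split => //.
    by rewrite -expgn_homeo_invE nw.
  move=> nz; exists (iter n (homeo_inv S) @^-1` W, [set N | (n <= N)%N]).
    by split => //=; exists n.
  by move=> [z' N] /= [Wz' nN]; exists n => //; right.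
by move=> [N _ /(_ N (leqnn N))]; exists N.
Qed.

(** Starting [N] steps ahead, the visits at times between [- N] and [N] all
    become forward visits; likewise for backward ones. *)
Lemma syndetic (W : set Z) : open W -> W !=set0 ->
  exists N, forall z, (exists2 n, (n < N)%N & W (iter n S z)) /\
    (exists2 n, (n < N)%N & W (iter n (homeo_inv S) z)).
Proof.
move=> oW W0; have [N NP] := two_sided_syndetic oW W0.
exists (N + N).+1 => z; split.
  have [n nN [Wn|Wn]] := NP (iter N S z).
    by exists (n + N)%N; rewrite ?iterD// ltnS leq_add2r.
  exists (N - n)%N; first by rewrite ltnS (leq_trans (leq_subr _ _))// leq_addr.
  by rewrite -iter_homeo_invK.
have [n nN [Wn|Wn]] := NP (iter N (homeo_inv S) z).
  exists (N - n)%N; first by rewrite ltnS (leq_trans (leq_subr _ _))// leq_addr.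
  by rewrite -iter_homeoK.
by exists (n + N)%N; rewrite ?iterD// ltnS leq_add2r.
Qed.

Hypothesis infZ : infinite_set [set: Z].

(** A periodic orbit is finite, hence closed, hence everything. *)
Lemma minimal_aperiodic z p : (0 < p)%N -> iter p S z != z.
Proof.
move=> p0; apply/eqP => Sp; apply: infZ.
have Spm k : iter (k * p) S z = z.
  by elim: k => [//|k IHk]; rewrite mulSn iterD IHk.
have fin : finite_set ((fun n => iter n S z) @` `I_p).
  exact/finite_image/finite_II.
have orb : full_orbit S z `<=` (fun n => iter n S z) @` `I_p.
  move=> _ [] [n _ <-].
    exists (n %% p)%N; first by rewrite /= ltn_mod.
    by rewrite expgn_homeoE {2}(divn_eq n p) addnC iterD Spm.
  exists ((n * p - n) %% p)%N; first by rewrite /= ltn_mod.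
  rewrite expgn_homeo_invE -{2}(Spm n) iter_homeo_invK ?leq_pmulr//.
  by rewrite {2}(divn_eq (n * p - n) p) addnC iterD Spm.
apply: (sub_finite_set _ fin) => w _; apply: contrapT => nw.
have : ~` ((fun n => iter n S z) @` `I_p) `&` full_orbit S z !=set0.
  apply: minS; first by exists w.
  have /accessible_finite_set_closed clf : accessible_space Z.
    exact/hausdorff_accessible/metric_hausdorff.
  by apply: closed_openC; apply: (clf _ fin).
by move=> [x [nx /orb]].
Qed.

Lemma separated_returns L : exists (z0 : Z) (r : R), 0 < r /\
  forall z i, (0 < i)%N -> (i <= L)%N -> mdist z0 z < r ->
    r <= mdist z0 (iter i S z).
Proof.
pose z0 : Z := point; exists z0.
elim: L => [|L [r [r0 rP]]]; first by exists 1; split => // z i; lia.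
have d0 : 0 < mdist z0 (iter L.+1 S z0).
  by rewrite mdist_gt0 eq_sym minimal_aperiodic.
set d := mdist _ _ in d0.
have d20 : 0 < d / 2 by rewrite divr_gt0.
have citer : continuous (iter L.+1 S).
  by apply: iter_continuous; exact: homeo_fun_continuous.
have /(cvgrPdist_lt (V := Z))/(_ _ d20) := citer z0.
rewrite -nbhs_ballE => -[t /= t0 tP].
exists (Num.min r (Num.min t (d / 2))); split; first by rewrite !lt_min r0 t0.
move=> z i i0; rewrite leq_eqVlt !lt_min => /orP[/eqP ->|iL] /and3P[zr zt zd].
  rewrite ge_min; apply/orP; right; rewrite ge_min; apply/orP; right.
  have := tP z; rewrite ballEmdist /= => /(_ zt) h.
  have := metric_triangle z0 (iter L.+1 S z) (iter L.+1 S z0).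
  rewrite /= in h *; rewrite (metric_sym (S (iter L S z))).
  by move: h; rewrite /d /=; lra.
by rewrite ge_min (rP z i)// .
Qed.

(** Let [u] be [0] at the centre and [m] outside of a ball whose points return
    to it only after more than [L] steps. Then [b z], the minimum of
    [n + u (S^n z)], and [a], its analogue for the past, count down and up with
    time except during visits to the ball. Taking [m] to be twice a waiting
    time for the half-size ball keeps both below the cut-off [m]. *)
Lemma slow_function L : exists (a b : Z -> R) (v : Z -> bool),
  [/\ [/\ continuous a, continuous b, forall z, 0 <= a z & forall z, 0 <= b z],
      forall z, ~~ v z -> a (S z) = a z + 1,
      forall z, ~~ v z -> b z = b (S z) + 1,
      forall z, `|Num.min (a (S z)) (b (S z)) - Num.min (a z) (b z)| <= 1 &
      forall z, (\sum_(n < L) v (iter n S z) <= 1)%N].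
Proof.
have [z0 [r [r0 rP]]] := separated_returns L.
have r20 : 0 < r / 2 by rewrite divr_gt0.
have oW : open (ball z0 (r / 2))° by exact: open_interior.
have [|N NP] := syndetic oW.
  by exists z0; exact: nbhsx_ballx.
have inW z : (ball z0 (r / 2))° z -> mdist z0 z < r / 2.
  by move=> /interior_subset; rewrite ballEmdist.
pose m := (N + N)%N.
pose u (z : Z) : R := m%:R * Num.min 1 (mdist z0 z / r).
have cu : continuous u.
  have c0 : continuous (fun _ : Z => z0) by move=> ?; exact: cvg_cst.
  have c1 : continuous (fun z : Z => z) by move=> ?; exact: cvg_id.
  have cd : continuous (fun z => mdist z0 z : R) := mdist_comp_continuous c0 c1.
  have cm : continuous (fun z => Num.min 1 (mdist z0 z / r)).
    apply: continuousT_min; first by move=> ?; exact: cvg_cst.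
    by move=> z; apply: cvgMl; exact: cd.
  by move=> z; apply: cvgMr; exact: cm.
have u0m z : 0 <= u z <= m%:R.
  apply/andP; split.
    by rewrite /u mulr_ge0// le_min ler01 divr_ge0 ?mdist_ge0// ltW.
  by rewrite -[leRHS]mulr1 ler_wpM2l// ge_min lexx.
have uW z : mdist z0 z < r / 2 -> u z <= N%:R.
  move=> zr; have : Num.min 1 (mdist z0 z / r) <= 1 / 2.
    rewrite ge_min; apply/orP; right; rewrite ler_pdivrMr//; lra.
  have : 0 <= N%:R :> R by [].
  by rewrite /u /m natrD; nra.
have uV z : r <= mdist z0 z -> u z = m%:R.
  by move=> rz; rewrite /u min_l ?mulr1// ler_pdivlMr// mul1r.
have bound (T : Z -> Z) (B : Z -> R) :
    (forall z, exists2 n, (n < N)%N & (ball z0 (r / 2))° (iter n T z)) ->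
    (forall z, B z = Num.min (u z) (1 + B (T z))) -> forall z, B z < m%:R.
  move=> TN BE z; have Bn n : B z <= n%:R + u (iter n T z).
    have BT n' w : B w <= n'%:R + B (iter n' T w).
      elim: n' w => [|n' IHn] w; first by rewrite add0r.
      rewrite iterSr -natr1 [_ + 1]addrC -addrA BE ge_min lerD2l IHn.
      by rewrite orbT.
    by apply: le_trans (BT n z) _; rewrite lerD2l BE ge_min lexx.
  have [n nN /inW/uW un] := TN z.
  apply: le_lt_trans (Bn n) _; rewrite /m natrD.
  have : n%:R < N%:R :> R by rewrite ltr_nat.
  by move: un; lra.
have [b [cb b0 bE]] := slow_fixpoint (@homeo_fun_continuous _ S) cu u0m.
have [A [cA A0 AE]] := slow_fixpoint (@homeo_inv_continuous _ S) cu u0m.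
have bm := bound _ _ (fun z => (NP z).1) bE.
have Am := bound _ _ (fun z => (NP z).2) AE.
pose a z := 1 + A (homeo_inv S z).
have aE z : a (S z) = 1 + Num.min (u z) (a z) by rewrite /a homeo_funK AE.
have am z : Num.min (u z) (a z) < m%:R by rewrite -AE.
exists a, b, (fun z => mdist z0 z < r); split.
- split => //; last by move=> z; rewrite addr_ge0.
  have cAS := continuousT_comp (@homeo_inv_continuous _ S) cA.
  by move=> z; apply: cvgD; [exact: cvg_cst | exact: cAS].
- move=> z; rewrite -leNgt => /uV uz; rewrite aE addrC; congr (_ + _).
  have := am z; rewrite uz; case: (leP m%:R (a z)) => //.
  by rewrite ltxx.
- move=> z; rewrite -leNgt => /uV uz; have := bm z;
  rewrite {2}bE {1}bE uz addrC.
  by case: (leP m%:R (b (S z) + 1)) => //; rewrite ltxx.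
- move=> z; rewrite aE; have := bE z.
  have := A0 z; move: (a z) (b z) (b (S z)) (u z) => a' b' b'' u'.
  rewrite ler_norml /Num.min; do !case: ifP => //; move=> *; apply/andP;
    split; lra.
- move=> z; elim: {-2}L (leqnn L) => [|l IHl] lL; first by rewrite big_ord0.
  rewrite big_ord_recr /=; case: (boolP (_ < r)) => [vl|_]; last first.
    by rewrite addn0 IHl// ltnW.
  rewrite addn1 ltnS leqn0 sum_nat_eq0; apply/forallP => i /=.
  rewrite eqb0 -leNgt leNgt; apply/negP => vi.
  have il := ltn_ord i.
  have li0 : (0 < l - i)%N by rewrite subn_gt0.
  have liL : (l - i <= L)%N by rewrite (leq_trans (leq_subr _ _))// ltnW.
  have := rP _ _ li0 liL vi; rewrite -iterD subnK ?(ltnW il)//.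
  by rewrite leNgt vl.
Qed.

End minimal_homeo.

(** * Slow cocycles with prescribed distribution *)

Section tower_cocycle.
Context {R : realType} {Y : pmetricType R}.
Hypothesis cY : compact [set: Y].
Variable GG : set (homeo Y).

Definition clamp01 (t : R) : R := Num.min 1 (Num.max 0 t).

Lemma clamp01_continuous : continuous clamp01.
Proof.
move=> t; apply: (@continuous_min R R (cst 1) (fun t => Num.max 0 t) t).
  exact: cvg_cst.
by apply: (@continuous_max R R (cst 0) id t); [exact: cvg_cst | exact: cvg_id].
Qed.

Lemma clamp01_itv t : 0 <= clamp01 t <= 1.
Proof. by rewrite /clamp01 ge_min lexx /= le_min ler01 le_max lexx. Qed.

Lemma clamp01_id t : 0 <= t <= 1 -> clamp01 t = t.
Proof. by move=> /andP[t0 t1]; rewrite /clamp01 max_r// min_r. Qed.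

Lemma clamp01_le0 t : t <= 0 -> clamp01 t = 0.
Proof. by move=> t0; rewrite /clamp01 max_l// min_r. Qed.

Lemma clamp01_ge1 t : 1 <= t -> clamp01 t = 1.
Proof. by move=> t1; rewrite /clamp01 max_r ?min_l// (le_trans ler01). Qed.

Lemma clamp01_lipschitz t t' : `|clamp01 t - clamp01 t'| <= `|t - t'|.
Proof.
have key x y : x <= y -> 0 <= clamp01 y - clamp01 x <= y - x.
  by rewrite /clamp01 /Num.min /Num.max; do !case: ifP => //; move=> *;
    apply/andP; split; lra.
have [tt'|/ltW t't] := leP t t'.
  have /andP[h1 h2] := key _ _ tt'.
  by rewrite distrC (distrC t) ger0_norm// ger0_norm// subr_ge0.
have /andP[h1 h2] := key _ _ t't.
by rewrite ger0_norm// ger0_norm// subr_ge0.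
Qed.

Lemma clamped_path (g h : homeo Y) : path_connected R GG -> GG g -> GG h ->
  exists p : R -> homeo Y, [/\ continuous p, forall t, GG (p t),
    forall t, p t = p (clamp01 t), p 0 = g & p 1 = h].
Proof.
move=> pc Gg Gh; have [p [cp p0 p1 pG]] := pc g h Gg Gh.
have in01 t : `[0, 1]%classic (clamp01 t).
  by rewrite /= in_itv /=; exact: clamp01_itv.
exists (p \o clamp01); split => /=.
- move=> t A /= nA.
  have /subspace_continuousP/(_ _ (in01 t)) := cp.
  move=> /(_ A nA); rewrite /= /within /= => nc.
  have nt : nbhs t [set t' | `[0,
    1]%classic (clamp01 t') -> A (p (clamp01 t'))].
    exact: (clamp01_continuous nc).
  by apply: (@filterS _ (nbhs t) _ _ _ _ nt) => t' /= H; exact: H (in01 t').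
- by move=> t; apply: pG; exists (clamp01 t).
- by move=> t; rewrite [in RHS]clamp01_id//; exact: clamp01_itv.
- by rewrite clamp01_le0.
- by rewrite clamp01_ge1.
Qed.

(** Uniform continuity of the path with respect to the left quotient
    [p t'^-1 p t], which is what a coboundary of a map through [p] sees. *)
Lemma path_modulus (p : R -> homeo Y) (e : R) :
  continuous p -> (forall t, p t = p (clamp01 t)) -> 0 < e ->
  exists2 d : R, 0 < d & forall t t', `|t - t'| < d ->
    forall y, mdist y ((p t')^-1%g (p t y)) < e.
Proof.
move=> cp pclamp e0.
have cK : compact (`[(0 : R), 1]%classic `*` [set: Y]).
  by apply: compact_setX => //; exact: segment_compact.
have /compact_near_coveringP cov := cK.
have := cov R (nbhs (0 : R))
  (fun u x => mdist x.2 ((p (x.1 + u))^-1%g (p x.1 x.2)) < e) _.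
case.
  move=> [t y] _.
  have cF : continuous (fun x : (R * Y) * R =>
      mdist x.1.2 ((p (x.1.1 + x.2))^-1%g (p x.1.1 x.1.2)) : R).
    have cf := @continuous_fst (R * Y)%type R.
    have cs := @continuous_snd (R * Y)%type R.
    have cff := continuousT_comp cf (@continuous_fst R Y).
    have cfs := continuousT_comp cf (@continuous_snd R Y).
    have cD : continuous (fun x : (R * Y) * R => x.1.1 + x.2).
      by move=> x; apply: cvgD; [exact: cff | exact: cs].
    have c1 := continuousT_comp (continuous_pairing (continuousT_comp cff cp)
      cfs)
      (@homeo_eval_continuous Y).
    have c2 := continuousT_comp (continuous_pairing (continuousT_comp cD cp) c1)
      (@homeo_eval_inv_continuous Y).
    exact: (mdist_comp_continuous cfs c2).
  have /(cvgr_lt _)/(_ e) := cF ((t, y), 0).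
  rewrite /= addr0 homeo_funK mdistxx => /(_ e0)[[A B] /= [nA nB] AB].
  by exists (A, B) => //= -[x u] /= [Ax Bu]; exact: (AB (x, u)).
move=> d /= d0 dP; exists d => // t t' tt' y.
rewrite (pclamp t) (pclamp t').
have := dP (clamp01 t' - clamp01 t).
rewrite /ball /= sub0r normrN => /(_ _ (clamp01 t, y)) /=.
rewrite (addrC (clamp01 t)) subrK; apply.
  by rewrite (le_lt_trans (clamp01_lipschitz _ _))// distrC.
by split => //; rewrite in_itv /=; exact: clamp01_itv.
Qed.

(** [K = P o min a b], where [P] runs periodically through
    [h_1, .., h_M] at a speed so low that unit steps of [min a b] change [K]
    little, and [a], [b] come from [slow_function] with windows so long that the
    three lost blocks of [window_count] are negligible. *)
Lemma tower_cocycle (Z : pmetricType R) (S : homeo Z) (V : set Y) (M : nat)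
    (h : 'I_M -> homeo Y) (eps e : R) :
  compact [set: Z] -> infinite_set [set: Z] -> minimal S ->
  path_connected R GG -> 0 < eps -> 0 < e -> (0 < M)%N -> (forall j,
    GG (h j)) ->
  (forall y : Y, M%:R^-1 * \sum_(j < M) \1_(h j @` (~` V)) y <= eps) ->
  exists K : Z -> homeo Y, [/\ continuous K, forall z, GG (K z),
    forall z y, mdist y ((K (S z))^-1%g (K z y)) < e &
    exists2 N, (0 < N)%N & forall z y,
      \sum_(n < N) \1_(~` V) ((K (iter n S z))^-1%g y) <= 3 * eps * N%:R].
Proof.
move=> cZ infZ minS pc eps0 e0 M0 hG hV.
case: M M0 h hG hV => // M' _ h hG hV; set M := M'.+1 in h hG hV *.
pose g j := h (inord (j %% M)).
have gG j : GG (g j) by exact: hG.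
have gM j : g j = g (j %% M)%N by rewrite /g modn_mod.
(* one path per residue modulo M, so that finitely many moduli suffice *)
have /choice[p0 p0P] : forall j : nat, exists p : R -> homeo Y,
    [/\ continuous p, forall t, GG (p t), forall t, p t = p (clamp01 t),
        p 0 = g j & p 1 = g j.+1].
  by move=> j; exact: clamped_path.
have mod n : exists2 d : R, 0 < d & forall j, (j < n)%N -> forall t t',
    `|t - t'| < d -> forall y, mdist y ((p0 j t')^-1%g (p0 j t y)) < e.
  elim: n => [|n [d d0 dP]]; first by exists 1.
  have [cp _ pcl _ _] := p0P n.
  have [d' d'0 d'P] := path_modulus cp pcl e0.
  exists (Num.min d d') => [|j]; first by rewrite lt_min d0.
  rewrite ltnS leq_eqVlt => /orP[/eqP ->|jn] t t';
    rewrite lt_min => /andP[td td'].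
    exact: d'P.
  exact: dP.
have {mod}[d d0 dP] := mod M.
pose Gam j := p0 (j %% M)%N.
have cGam j : continuous (Gam j) by have [] := p0P (j %% M)%N.
have Gam_cl j t : Gam j t = Gam j (clamp01 t) by have [_ _ + _ _] := p0P (j %%
  M)%N; apply.
have Gam0 j t : t <= 0 -> Gam j t = g j.
  move=> t0; rewrite Gam_cl clamp01_le0// /Gam.
  by have [_ _ _ -> _] := p0P (j %% M)%N; rewrite -gM.
have Gam1 j t : 1 <= t -> Gam j t = g j.+1.
  move=> t1; rewrite Gam_cl clamp01_ge1// /Gam;
    have [_ _ _ _ ->] := p0P (j %% M)%N.
  by rewrite gM [RHS]gM -[in LHS]addn1 modnDml addn1.
(* 1 / k, the fraction of time spent in transitions, is at most eps; the step
   1 / (k * q) moves the path parameter by 1 / q < d *)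
pose k := (Num.truncn eps^-1).+2.
have k2 : (2 <= k)%N by [].
have k0 : 0 < k%:R :> R by rewrite ltr0n.
have keps : k%:R^-1 <= eps.
  rewrite -[leRHS]invrK lef_pV2 ?posrE ?invr_gt0//.
  apply: le_trans (ltW (truncnS_gt _)) _; by rewrite ler_nat.
pose q := (Num.truncn d^-1).+1.
have q0 : (0 < q)%N by [].
have qd : q%:R^-1 < d.
  by rewrite -[ltRHS]invrK ltf_pV2 ?posrE ?invr_gt0 ?ltr0n//; exact: truncnS_gt.
pose lam := (k * q)%N.
have lam0 : 0 < lam%:R :> R by rewrite ltr0n muln_gt0.
pose P t := profile Gam k (t / lam%:R).
have lam2 : lam%:R^-1 <= 1 / 2 :> R.
  rewrite div1r lef_pV2 ?posrE// (ler_nat R 2).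
  by rewrite (leq_trans k2)// leq_pmulr.
have Pmod t t' : 0 <= t -> 0 <= t' -> `|t - t'| <= 1 ->
    forall y, mdist y ((P t')^-1%g (P t y)) < e.
  move=> t0 t'0 tt'.
  have st : 0 <= t / lam%:R by rewrite divr_ge0// ltW.
  have st' : 0 <= t' / lam%:R by rewrite divr_ge0// ltW.
  have stt' : `|t / lam%:R - t' / lam%:R| <= lam%:R^-1.
    have lV : 0 <= lam%:R^-1 :> R by rewrite invr_ge0.
    by rewrite -mulrBl normrM (ger0_norm lV) ler_piMl.
  have main j (s s' : R) : `|s - s'| <= lam%:R^-1 -> forall y,
      mdist y ((Gam j (k%:R * (s' - j%:R) - k%:R + 1))^-1%g
               (Gam j (k%:R * (s - j%:R) - k%:R + 1) y)) < e.
    move=> ss'; apply: dP; first by rewrite ltn_mod.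
    have -> : k%:R * (s - j%:R) - k%:R + 1 - (k%:R * (s' - j%:R) - k%:R + 1) =
      k%:R * (s - s') by ring.
    rewrite normrM ger0_norm 1?ltW//; apply: le_lt_trans qd.
    apply: (@le_trans _ _ (k%:R * lam%:R^-1)); first by rewrite ler_pM2l.
    rewrite /lam natrM invfM mulrA divff ?gt_eqF// mul1r //.
  have [le|/ltW le] := leP (t / lam%:R) (t' / lam%:R).
    rewrite /P (profile_window k2 Gam0 Gam1 st le); last first.
      by move: stt'; rewrite ler_norml => /andP[h1 h2]; lra.
    exact: main.
  rewrite /P (profile_window k2 Gam0 Gam1 st' le); last first.
    by move: stt'; rewrite ler_norml => /andP[h1 h2]; lra.
  exact: main.
(* one block is a period of P; W blocks make three lost ones negligible *)
pose Q := (M * lam)%N; pose W := (Num.truncn (3 / eps)).+1.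
have Q0 : (0 < Q)%N by rewrite muln_gt0 /lam muln_gt0.
have [a [b [v [[ca cb a0 b0] av bv ab v1]]]] := slow_function cZ minS infZ (W
  * Q).
pose Th z := Num.min (a z) (b z).
have Th0 z : 0 <= Th z by rewrite le_min a0 b0.
have cTh : continuous Th by exact: continuousT_min.
exists (fun z => P (Th z)); split.
- (* near z0 the parameter stays in an interval of length 1 / 2 *)
  move=> z0; pose s1 := Num.max 0 (Th z0 / lam%:R - 1 / 8).
  have s10 : 0 <= s1 by rewrite le_max lexx.
  pose j := Num.truncn s1.
  have cs : continuous (fun z => Th z / lam%:R).
    by move=> z; apply: cvgMl; exact: cTh.
  have c1 : continuous (fun z =>
    Gam j (k%:R * (Th z / lam%:R - j%:R) - k%:R + 1)).
    apply: continuousT_comp; last exact: cGam.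
    move=> z; apply: cvgD; last exact: cvg_cst.
    apply: cvgB; last exact: cvg_cst.
    apply: cvgMr; apply: cvgB; last exact: cvg_cst.
    exact: cs.
  have e80 : 0 < 1 / 8 :> R by lra.
  have /(cvgrPdist_lt (V := R^o))/(_ _ e80) nz := cs z0.
  have E z : mdist (Th z0 / lam%:R : R^o) (Th z / lam%:R) < 1 / 8 ->
      P (Th z) = Gam j (k%:R * (Th z / lam%:R - j%:R) - k%:R + 1).
    rewrite /mdist /= ltr_norml => /andP[h1 h2].
    have : 0 <= Th z / lam%:R by rewrite divr_ge0// ltW.
    have : 0 <= Th z0 / lam%:R by rewrite divr_ge0// ltW.
    move=> h3 h4; apply: (profile_window k2 Gam0 Gam1) => //.
      by rewrite /s1 ge_max h4 /=; lra.
    by rewrite /s1; case: (leP 0 (Th z0 / lam%:R - 1 / 8)) => h5; lra.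
  have Ez0 := E z0; rewrite mdistxx in Ez0.
  move=> A; rewrite (Ez0 e80) => nA.
  have nA' : nbhs z0 [set z | A (Gam j (k%:R * (Th z / lam%:R - j%:R) - k%:R +
    1))].
    exact: c1.
  by apply: (@filterS _ (nbhs z0) _ _ _ _ (filterI nz nA')) => z [/= /E ->].
- by move=> z; have [_ H _ _ _] := p0P (Num.truncn (Th z / lam%:R) %% M)%N;
  exact: H.
- move=> z y; apply: Pmod => //.
  by rewrite distrC; exact: ab.
exists (W * Q)%N; first by rewrite muln_gt0.
move=> z y; pose beta0 (f : homeo Y) : R := \1_(~` V) (f^-1%g y).
have b01 f : 0 <= beta0 f <= 1.
  by rewrite /beta0 indicE; case: (_ \in _); rewrite lexx ler01.
have count t : 0 <= t ->
    \sum_(i < Q) beta0 (P (t + i%:R)) <= (eps + k%:R^-1) * Q%:R.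
  move=> t0; apply: (@profile_count R _ g Gam k k2 Gam0 beta0 M q eps t) => //.
  have := hV y; rewrite mulrC ler_pdivrMr ?ltr0n// => /(le_trans _); apply.
  rewrite le_eqVlt; apply/orP; left; apply/eqP; apply: eq_bigr => j _.
  rewrite /beta0 /g modn_small// inord_val !indicE; congr (_%:R).
  congr (nat_of_bool _); apply/idP/idP; rewrite !inE.
    by move=> Vy; exists ((h j)^-1%g y) => //; exact: homeo_invK.
  by move=> [x Vx <-]; rewrite /= homeo_funK.
have WQ : 3 * Q%:R <= eps * (W * Q)%:R.
  rewrite natrM mulrA ler_wpM2r// mulrC -ler_pdivrMr//.
  by rewrite ltW// truncnS_gt.
have epsk : 0 <= eps + k%:R^-1 by rewrite addr_ge0 ?invr_ge0// ltW.
have := @window_count R (fun t => beta0 (P t)) (fun n => a (iter n S z))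
  (fun n => b (iter n S z)) (fun n => v (iter n S z)) Q W (eps + k%:R^-1) Q0
  epsk (fun t => b01 (P t)) count (fun n => a0 _) (fun n => b0 _)
  (fun n => av _) (fun n => bv _) (v1 z).
move=> /le_trans; apply.
have : (eps + k%:R^-1) * (W * Q)%:R <= (2 * eps) * (W * Q)%:R.
  by rewrite ler_wpM2r//; lra.
by move: WQ; lra.
Qed.

End tower_cocycle.

(** * Density of the two conditions *)

Section generic.
Context {R : realType} {Z Y : pmetricType R}.
Variables (S : homeo Z) (GG : set (homeo Y)).
Hypotheses (cZ : compact [set: Z]) (infZ : infinite_set [set: Z]).
Hypotheses (minS : minimal S) (cY : compact [set: Y]).
Hypotheses (gGG : group_closed (mem GG)) (clGG : closed GG).
Hypothesis pcGG : path_connected R GG.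
Hypothesis spreading : forall (V : set Y) (eps : R),
  open V -> V !=set0 -> 0 < eps ->
  exists (M : nat) (h : 'I_M -> homeo Y), [/\ (0 < M)%N, forall j, GG (h j)
    & forall y : Y, M%:R^-1 * \sum_(j < M) \1_(h j @` (~` V)) y <= eps].
Local Notation Cob := (closure (coboundaries (Z := Z) GG S)).

Let GG_mul f g : GG f -> GG g -> GG (f * g)%g.
Proof.
move=> Gf Gg; have := group_closedM gGG (x := f) (y := g).
by rewrite !inE; apply.
Qed.

Let GG_inv f : GG f -> GG f^-1%g.
Proof. by move=> Gf; have := group_closedV gGG (x := f); rewrite !inE;
  apply. Qed.

(** The skew product of a coboundary is conjugate to [S] times the identity. *)
Lemma iter_coboundary (H : cocycles (Z := Z) GG) (F : Z -> homeo Y) n z y :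
  (forall z, cocycle_fun H z = ((F (S z))^-1 * F z)%g) ->
  iter n (skew_product S H) (z, y) = (iter n S z,
    (F (iter n S z))^-1%g (F z y)).
Proof.
move=> HF; elim: n => [|n IHn] /=; first by rewrite homeo_funK.
by rewrite IHn /skew_fun /= HF /= homeo_invK.
Qed.

(** Near any coboundary, defined by some [G], there are the coboundaries defined
    by [K G] with [K] from [tower_cocycle]. The condition [P] may choose the
    set [V] and the precision [eta] after seeing [G]. *)
Lemma dense_of_towers (P : set (cocycles (Z := Z) GG)) :
  (forall G : cocycles (Z := Z) GG, exists (V : set Y) (eta : R),
    [/\ open V, V !=set0, 0 < eta &
      forall (K : Z -> homeo Y) N (H : cocycles (Z := Z) GG), (0 < N)%N ->
        (forall z y, \sum_(n < N) \1_(~` V) ((K (iter n S z))^-1%g y) <= eta *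
          N%:R) ->
        (forall z, cocycle_fun H z =
          ((K (S z) * cocycle_fun G (S z))^-1 * (K z * cocycle_fun G z))%g) ->
        P H]) ->
  dense [set G : Cob | P (val G)].
Proof.
move=> PG O [G0 OG0] oO.
have /cob_nbhsP[e e0 eO] := open_nbhs_nbhs (conj oO OG0).
have e20 : 0 < e / 2 by rewrite divr_gt0.
have [H [[G HG] G0H]] := near_coboundary G0 e20.
have [V [eta [oV V0 eta0 PV]]] := PG G.
have cG := @cocycle_continuous _ _ _ G.
have GGz z : GG (cocycle_fun G z) by have [_] := set_valP G; apply.
have [d d0 dP] := fiber_equicontinuous cY cZ (family_inv_eval_continuous cG)
  e20.
have eta30 : 0 < eta / 3 by rewrite divr_gt0.
have [M [h [M0 hG hV]]] := spreading oV V0 eta30.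
have [K [cK KG Kd [N N0 KN]]] := tower_cocycle cY cZ infZ minS pcGG eta30 d0
  M0 hG hV.
have cKG := family_mul_continuous cY cK cG.
have KGG z : GG (K z * cocycle_fun G z)%g by exact: GG_mul.
have cKGS := continuousT_comp (@homeo_fun_continuous _ S) cKG.
have cH' := family_mul_continuous cY (family_inv_continuous cY cKGS) cKG.
have H'G z : GG ((K (S z) * cocycle_fun G (S z))^-1 * (K z * cocycle_fun G
  z))%g.
  by apply: GG_mul => //; exact: GG_inv.
pose H' := mk_cocycle cH' H'G.
have H'cob : Cob H'.
  by apply: subset_closure; exists (mk_cocycle cKG KGG).
exists (@exist _ (fun G => G \in Cob) H' (mem_set H'cob)); split; last first.
  apply: (PV K N H') => // z y; apply: le_trans (KN z y) _.
  by rewrite le_eqVlt; apply/orP; left; apply/eqP; field.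
apply: eO => z y /=.
have := metric_triangle (cocycle_fun (val G0) z y) (cocycle_fun H z y)
  (cocycle_fun H' z y).
have h1 := G0H z y.
have h2 : mdist (cocycle_fun H z y) (cocycle_fun H' z y) < e / 2.
  by rewrite HG; exact: (dP (S z) _ _ (Kd z (cocycle_fun G z y))).
by move=> h3; apply: (le_lt_trans h3); rewrite [ltRHS](splitr e) ltrD.
Qed.

(** Choose [V] so small that all [G_z^-1] map it to a set of small diameter. In
    the bad times the distance is at most a bound [B] for the diameter of
    [Y]. *)
Lemma dense_mean_contracting (e : R) : 0 < e ->
  dense [set G : Cob | mean_contracting S e (val G)].
Proof.
move=> e0; apply: dense_of_towers => G.
have cG := @cocycle_continuous _ _ _ G.
have e40 : 0 < e / 4 by rewrite divr_gt0.
have [d d0 dP] := fiber_equicontinuous cY cZ (family_inv_eval_continuous cG)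
  e40.
have [B B0 BP] := compact_bounded_dist cY.
exists (ball point (d / 2))°, (e / (8 * B)).
have d20 : 0 < d / 2 by rewrite divr_gt0.
split; [exact: open_interior | | | ].
- by exists point; exact: nbhsx_ballx.
- by rewrite divr_gt0// mulr_gt0.
move=> K N H N0 KN HK; exists N => // z y1 y2.
set V := (ball point (d / 2))° in KN *.
have VP v v' : V v -> V v' -> mdist v v' < d.
  move=> /interior_subset + /interior_subset; rewrite !ballEmdist /= => h1 h2.
  by have := metric_triangle v point v'; rewrite (metric_sym v point); lra.
pose F z := (K z * cocycle_fun G z)%g.
pose bad y n : R := \1_(~` V) ((K (iter n S z))^-1%g y).
have bad01 y n : 0 <= bad y n.
  by rewrite /bad indicE.
have step (n : 'I_N) : mdist (iter n (skew_product S H) (z, y1)).2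
    (iter n (skew_product S H) (z, y2)).2 <=
    e / 4 + B * (bad (F z y1) n + bad (F z y2) n).
  rewrite !(iter_coboundary _ _ _ HK) /=.
  have [V1|V1] := pselect (V ((K (iter n S z))^-1%g (F z y1))); last first.
    apply: le_trans (BP _ _) _; have := bad01 (F z y2) n.
    rewrite {2}/bad indicE mem_set//=; nra.
  have [V2|V2] := pselect (V ((K (iter n S z))^-1%g (F z y2))); last first.
    apply: le_trans (BP _ _) _; have := bad01 (F z y1) n.
    rewrite {3}/bad indicE mem_set//=; nra.
  have := dP (iter n S z) _ _ (VP _ _ V1 V2) => /= h.
  apply: (le_trans (ltW h)); rewrite lerDl mulr_ge0 ?addr_ge0// ltW//.
have K1 := KN z (F z y1); have K2 := KN z (F z y2).
have NR : 0 < N%:R :> R by rewrite ltr0n.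
apply: (@le_lt_trans _ _ (\sum_(n < N) (e / 4 + B * (bad (F z y1) n + bad (F z
  y2) n)))).
  by apply: ler_sum => n _; exact: step.
rewrite big_split /= sumr_const card_ord -mulr_sumr big_split /= -mulr_natr.
have : B * (\sum_(i < N) bad (F z y1) i + \sum_(i < N) bad (F z y2) i) <=
    B * (e / (8 * B) * N%:R + e / (8 * B) * N%:R).
  by rewrite ler_pM2l// lerD.
have -> : B * (e / (8 * B) * N%:R + e / (8 * B) * N%:R) = e / 4 * N%:R.
  by field; rewrite gt_eqF.
have : 0 < e * N%:R by rewrite mulr_gt0.
by lra.
Qed.

(** Choose [W] and [V] such that [(z, G_z^-1 v)] lies in [U] for [z] in [W] and
    [v] in [V]. Visits to [W] recur within [L] steps, hence have frequency at
    least [1 / L]; if the bad times have a smaller frequency, some visit to [W]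
    is not bad. *)
Lemma dense_visits (U : set (Z * Y)) : open U -> U !=set0 ->
  dense [set G : Cob | visits S U (val G)].
Proof.
move=> oU [[z0 y0] U0]; apply: dense_of_towers => G.
have cG := @cocycle_continuous _ _ _ G.
have cf : continuous (fun p : Z * Y => (p.1, (cocycle_fun G p.1)^-1%g p.2)).
  exact: (continuous_pairing (@continuous_fst Z Y)
    (family_inv_eval_continuous cG)).
have := cf (z0, cocycle_fun G z0 y0) U.
rewrite /= homeo_funK => /(_ (open_nbhs_nbhs (conj oU U0))).
move=> [[W V] /= [nW nV] WVU].
have [L LP] : exists N, forall z, (exists2 n, (n < N)%N & W° (iter n S z)) /\
    (exists2 n, (n < N)%N & W° (iter n (homeo_inv S) z)).
  apply: syndetic => //; first exact: open_interior.
  by exists z0.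
have L0 : (0 < L)%N by have [[n nL _] _] := LP z0; exact: leq_ltn_trans nL.
exists V°, (1 / (2 * L%:R)); split.
- exact: open_interior.
- by exists (cocycle_fun G z0 y0).
- by rewrite divr_gt0// mulr_gt0// ltr0n.
move=> K N H N0 KN HK; exists (N + L)%N => -[z y].
pose F z := (K z * cocycle_fun G z)%g.
apply: contrapT => nvis.
pose bad n : R := \1_(~` V°) ((K (iter n S z))^-1%g (F z y)).
have badP n : (n < N + L)%N -> W° (iter n S z) -> bad n = 1.
  move=> nNL Wn; rewrite /bad indicE mem_set// => Vn; apply: nvis.
  exists n => //; rewrite (iter_coboundary _ _ _ HK).
  apply: (WVU (iter n S z, (K (iter n S z))^-1%g (F z y))).
  by split; exact: interior_subset.
have bad0 n : 0 <= bad n by rewrite /bad indicE.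
have up : \sum_(i < L) \sum_(n < N) bad (n + i)%N <= L%:R * (1 / (2 * L%:R) *
  N%:R).
  have -> : L%:R * (1 / (2 * L%:R) * N%:R) = \sum_(i < L) (1 / (2 * L%:R) *
    N%:R) :> R.
    by rewrite sumr_const card_ord -[RHS]mulr_natl.
  apply: ler_sum => i _; under eq_bigr do rewrite /bad iterD.
  exact: KN.
have lo : N%:R <= \sum_(i < L) \sum_(n < N) bad (n + i)%N.
  rewrite exchange_big /=.
  have -> : N%:R = \sum_(n < N) 1 :> R by rewrite sumr_const card_ord.
  apply: ler_sum => n _.
  have [[i iL Wi] _] := LP (iter n S z).
  rewrite (bigD1 (Ordinal iL)) //= badP.
  - by rewrite lerDl sumr_ge0.
  - by have := ltn_ord n; lia.
  - by rewrite addnC iterD.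
have NR : 0 < N%:R :> R by rewrite ltr0n.
have : L%:R * (1 / (2 * L%:R) * N%:R) = N%:R / 2 :> R.
  by field; rewrite pnatr_eq0 -lt0n.
by move: up lo; lra.
Qed.

End generic.

(** * The generic skew product *)

Section generic_properties.
Context {R : realType} {Z Y : pmetricType R}.
Variables (S : homeo Z) (GG : set (homeo Y)).
Hypotheses (cZ : compact [set: Z]) (cY : compact [set: Y]).
Local Notation Cob := (closure (coboundaries (Z := Z) GG S)).

(** The section is the invariant section of a coboundary [H] so close to [G]
    that the first [N] iterates of both skew products are close. *)
Lemma mean_contracting_sections (G : Cob) (e : R) : 0 < e ->
  mean_contracting S (e / 2) (val G) ->
  let T := skew_product S (val G) in
  exists s : Z -> Y, [/\ continuous s,
    (forall z, mdist (T (z, s z)).2 (s (S z)) <= e) &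
    exists2 N, (0 < N)%N & forall x,
      \sum_(n < N) mdist (s (iter n T x).1) (iter n T x).2 <= e * N%:R].
Proof.
move=> e0 [N N0 NP] T; have e20 : 0 < e / 2 by rewrite divr_gt0.
have /cob_nbhsP[d d0 dP] := near_iter cZ cY G N e20.
have [H [[G' HG'] GH]] := near_coboundary G d0.
have Hcob : Cob H by apply: subset_closure; exists G'.
have close := dP (@exist _ (fun G => G \in Cob) H (mem_set Hcob)) GH.
pose s z := (cocycle_fun G' z)^-1%g (point : Y).
have cs : continuous s.
  have c0 : continuous (fun z : Z => (z, point : Y)).
    by apply: continuous_pairing; move=> ?; [exact: cvg_id | exact: cvg_cst].
  exact: (continuousT_comp c0
    (family_inv_eval_continuous (@cocycle_continuous _ _ _ G'))).
have sH n z : iter n (skew_product S H) (z, s z) = (iter n S z, s (iter n S z)).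
  by rewrite (iter_coboundary _ _ _ HG') /s homeo_invK.
have sT n z : (n <= N)%N -> mdist (s (iter n S z)) (iter n T (z,
  s z)).2 < e / 2.
  by move=> nN; have := close (z, s z) n nN; rewrite /= sH.
have T1 n x : (iter n T x).1 = iter n S x.1.
  by elim: n => [//|n IHn]; rewrite /= IHn.
exists s; split => //.
  move=> z; rewrite metric_sym; have := sT 1%N z N0; rewrite /= => h.
  by rewrite ltW// (lt_trans h)//; lra.
exists N => // -[z y].
apply: (@le_trans _ _ (\sum_(n < N) (e / 2 +
    mdist (iter n T (z, s z)).2 (iter n T (z, y)).2))).
  apply: ler_sum => n _; rewrite T1 /=.
  apply: (le_trans (metric_triangle _ (iter n T (z, s z)).2 _)).
  by rewrite lerD2r ltW// sT// ltnW.
rewrite big_split /= sumr_const card_ord -mulr_natr.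
by have := ltW (NP z (s z) y); rewrite -/T; lra.
Qed.

Lemma visits_minimal (B : set (set (Z * Y))) (G : cocycles (Z := Z) GG) :
  basis B -> (forall U, B U -> U !=set0 -> visits S U G) ->
  minimal (skew_product S G).
Proof.
move=> [_ bB] BG x O [p Op] oO.
have [U [BU Up] UO] := bB p O (open_nbhs_nbhs (conj oO Op)).
have [N /(_ x)[n _ Un]] : visits S U G by apply: BG => //; exists p.
exists (iter n (skew_product S G) x); split; first exact: UO.
by left; exists n => //; exact: expgn_homeoE.
Qed.

End generic_properties.

Theorem theorem3p1 (R : realType) (Z Y : pmetricType R) (S : homeo Z)
    (GG : set (homeo Y)) :
  compact [set: Z] -> infinite_set [set: Z] -> strictly_ergodic R S ->
  compact [set: Y] ->
  group_closed (mem GG) -> closed GG -> path_connected R GG ->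
  (forall (V : set Y) (eps : R), open V -> V !=set0 -> 0 < eps ->
     exists (M : nat) (h : 'I_M -> homeo Y),
       [/\ (0 < M)%N, forall j, GG (h j)
         & forall y : Y,
             M%:R^-1 * \sum_(j < M) \1_(h j @` (~` V)) y <= eps]) ->
  residual [set G : closure (coboundaries GG S) |
    minimal (skew_product S (val G)) /\
    isomorphic_extension R (skew_product S (val G)) S fst].
Proof.
move=> cZ infZ [minS [nu nuS]] cY gGG clGG pcGG spreading.
have [B cB bB] := prod_second_countable cZ cY.
have [f fB] : exists f : set (Z * Y) -> nat, {in B &, injective f}.
  by apply/countable_injP.
pose Cob := closure (coboundaries (Z := Z) GG S).
(* f numbers the base; it is injective, so an index gives one condition *)
pose E (n : nat) : set Cob := if odd n
  then [set G | forall U, B U -> U !=set0 -> f U = n./2 -> visits S U (val G)]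
  else [set G | mean_contracting S (n./2.+1%:R^-1) (val G)].
have EP n : open (E n) /\ dense (E n).
  rewrite /E; case: ifP => _; last first.
    by split; [exact: open_mean_contracting | exact: dense_mean_contracting].
  have [[U [BU U0 fU]]|nU] := pselect (exists U, [/\ B U,
    U !=set0 & f U = n./2]).
    rewrite (_ : [set G | _] = [set G : Cob | visits S U (val G)]).
      have oU : open U by have [+ _] := bB; apply.
      by split; [exact: open_visits | exact: dense_visits].
    apply/seteqP; split => G /=; first by apply.
    move=> GU U' BU' U'0 fU'; rewrite (_ : U' = U)//.
    by apply: fB; rewrite ?inE// fU' fU.
  rewrite (_ : [set G | _] = setT); first by split;
    [exact: openT | move=> O O0 _; rewrite setIT].
  by apply/seteqP; split => // G _ U BU U0 fU; exfalso; apply: nU; exists U.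
exists (\bigcap_n E n); split.
- by exists E => // n; exact: (EP n).1.
- by apply: cob_baire => // n; [exact: (EP n).1 | exact: (EP n).2].
move=> G EG; split.
  apply: visits_minimal bB _ => U BU U0.
  have := EG (f U).*2.+1 I; rewrite /E /= odd_double /= uphalf_double.
  by apply.
apply: (isomorphic_extension_of_sections cZ cY _ nuS) => // e e0.
apply: mean_contracting_sections => //.
pose n := Num.truncn (2 / e).
have := EG n.*2 I; rewrite /E odd_double doubleK => -[N N0 NP].
exists N => // z y1 y2; apply: lt_le_trans (NP z y1 y2) _.
rewrite ler_wpM2r// -[leRHS]invrK lef_pV2 ?posrE ?invr_gt0 ?divr_gt0//.
by rewrite invf_div ltW// truncnS_gt.
Qed.
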